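(* Suppose $(A,\Gamma)$ is a flat Hopf algebroid. Then a $\Gamma$-comodule $M$ is dualizable in $\Gamma\text{-comod}$ if and only if $M$ is finitely generated and projective as an $A$-module.
   Context: Fix a commutative ground ring $k$. A Hopf algebroid $(A,\Gamma)$ is a cogroupoid object in commutative $k$-algebras: commutative $k$-algebras $A,\Gamma$ with $k$-algebra maps $\eta_L,\eta_R:A\to\Gamma$ (corepresenting source and target), $\varepsilon:\Gamma\to A$ (identities), $\chi:\Gamma\to\Gamma$ (inverses, interchanging $\eta_L$ and $\eta_R$) and $\Delta:\Gamma\to\Gamma\otimes_A\Gamma$ (composition). $\Gamma$ is an $A$-bimodule, left via $\eta_L$ and right via $\eta_R$; $\Gamma\otimes_A M$ uses the right structure. It is flat if $\Gamma$ is flat as a right $A$-module. A ($\Gamma$-)comodule is a left $A$-module $M$ with a coassociative, counital $A$-linear map $\psi:M\to\Gamma\otimes_A M$; the category of comodules is $\Gamma\text{-comod}$. It is symmetric monoidal with $M\wedge N=M\otimes_A N$ (tensor product of left $A$-modules) with coaction $M\otimes N\xrightarrow{\psi\otimes\psi}(\Gamma\otimes M)\otimes(\Gamma\otimes N)\xrightarrow{g}\Gamma\otimes M\otimes N$, $g(x\otimes m\otimes y\otimes n)=xy\otimes m\otimes n$, and unit $A$ with coaction $\eta_L$. For $(A,\Gamma)$ flat it is closed, with internal hom $F(M,N)$, characterized by $\Gamma\text{-comod}(L,F(M,N))\cong\Gamma\text{-comod}(L\wedge M,N)$. A comodule $M$ is dualizable (strongly dualizable) if the natural map $F(M,A)\wedge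 N\to F(M,N)$ is an isomorphism for all comodules $N$. *)

(* Defs.v *)
From HB Require Import structures.
From mathcomp Require Import all_boot all_algebra.
From mathcomp Require Import boolp.

Set Implicit Arguments.
Unset Strict Implicit.
Unset Printing Implicit Defensive.

Import GRing.Theory.
Local Open Scope ring_scope.
Local Open Scope quotient_scope.

(* Rings are [comPzRingType]s, so that the zero ring is allowed; a commutative
   k-algebra is a commutative ring with a ring morphism from k. *)

Definition mklin (A : pzRingType) (U V : lmodType A) (f : U -> V)
    (h : linear f) : {linear U -> V} :=
  HB.pack f (GRing.isLinear.Build A U V *:%R f h).

Lemma lin_ext (A : pzRingType) (U V : lmodType A) (f g : {linear U -> V}) :
  f =1 g -> f = g.
Proof.
case: f => f [[f1] [f2]]; case: g => g [[g1] [g2]] /= /funext e.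
rewrite {}e in f1 f2 *.
by rewrite (Prop_irrelevance f1 g1) (Prop_irrelevance f2 g2).
Qed.

Section Tensor.
Variables (A : comPzRingType) (M N : lmodType A).

(* The congruence on formal sums presenting the tensor product over A. *)
Inductive tens_eq : seq (M * N) -> seq (M * N) -> Prop :=
| TensRefl s : tens_eq s s
| TensSym s t : tens_eq s t -> tens_eq t s
| TensTrans s t u : tens_eq s t -> tens_eq t u -> tens_eq s u
| TensCat s s' t t' :
    tens_eq s s' -> tens_eq t t' -> tens_eq (s ++ t) (s' ++ t')
| TensComm s t : tens_eq (s ++ t) (t ++ s)
| TensZero n : tens_eq [:: (0, n)] [::]
| TensAddl m m' n : tens_eq [:: (m + m', n)] [:: (m, n); (m', n)]
| TensAddr m n n' : tens_eq [:: (m, n + n')] [:: (m, n); (m, n')]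
| TensScale a m n : tens_eq [:: (a *: m, n)] [:: (m, a *: n)].

Definition tens_eqb s t := `[< tens_eq s t >].

Lemma tens_eqb_refl : reflexive tens_eqb.
Proof. by move=> s; apply/asboolP; constructor. Qed.

Lemma tens_eqb_sym : symmetric tens_eqb.
Proof. by move=> s t; apply/asboolP/asboolP; exact: TensSym. Qed.

Lemma tens_eqb_trans : transitive tens_eqb.
Proof.
move=> t s u /asboolP st /asboolP tu; apply/asboolP; exact: TensTrans st tu.
Qed.

Canonical tens_equiv :=
  EquivRel tens_eqb tens_eqb_refl tens_eqb_sym tens_eqb_trans.

Definition tens := {eq_quot tens_equiv}.
HB.instance Definition _ := Choice.on tens.
HB.instance Definition _ := EqQuotient.on tens.

Definition tens_of (s : seq (M * N)) : tens := \pi_tens s.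

Definition pure (m : M) (n : N) : tens := tens_of [:: (m, n)].

(* The additive map induced by [f] on the tensor product; only meaningful when
   [f] is balanced, see [tlift_pure]. *)
Definition tlift (P : zmodType) (f : M -> N -> P) (t : tens) : P :=
  \sum_(p <- repr t) f p.1 p.2.

Record balanced (P : zmodType) (f : M -> N -> P) : Prop := Balanced {
  balDl : forall m m' n, f (m + m') n = f m n + f m' n;
  balDr : forall m n n', f m (n + n') = f m n + f m n';
  balZ : forall a m n, f (a *: m) n = f m (a *: n)
}.

Lemma tens_ofP s t : tens_of s = tens_of t <-> tens_eq s t.
Proof.
by split=> [/eqmodP/asboolP | st] //; apply/eqmodP/asboolP.
Qed.

Lemma reprK_tens (t : tens) : tens_of (repr t) = t.
Proof. exact: reprK. Qed.

Lemma tlift_of (P : zmodType) (f : M -> N -> P) s :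
  balanced f -> tlift f (tens_of s) = \sum_(p <- s) f p.1 p.2.
Proof.
move=> [fDl fDr fZ].
have : tens_eq (repr (tens_of s)) s by apply/tens_ofP; rewrite reprK_tens.
rewrite /tlift; move: (repr _) => r; elim=> {r s} //=.
- by move=> s t u _ -> _ ->.
- by move=> s s' t t' _ e _ e'; rewrite !big_cat /= e e'.
- by move=> s t; rewrite !big_cat /= addrC.
- move=> n; rewrite big_seq1 big_nil /=.
  by apply: (addrI (f 0 n)); rewrite -fDl !addr0.
- by move=> m m' n; rewrite !big_cons !big_nil !addr0 /= fDl.
- by move=> m n n'; rewrite !big_cons !big_nil !addr0 /= fDr.
- by move=> a m n; rewrite !big_seq1 /= fZ.
Qed.

Definition tens_map (f : M -> M) (s : seq (M * N)) :=
  [seq (f p.1, p.2) | p <- s].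

Lemma tens_eq_map (f : {additive M -> M}) s t :
  (forall a m, f (a *: m) = a *: f m) ->
  tens_eq s t -> tens_eq (tens_map f s) (tens_map f t).
Proof.
move=> fZ; elim=> {s t} /=; rewrite /tens_map.
- by move=> *; constructor.
- by move=> *; apply: TensSym.
- by move=> s t u _ + _; apply: TensTrans.
- by move=> s s' t t' _ + _; rewrite !map_cat; apply: TensCat.
- by move=> *; rewrite !map_cat; apply: TensComm.
- by move=> n /=; rewrite raddf0; apply: TensZero.
- by move=> *; rewrite /= raddfD; apply: TensAddl.
- by move=> *; apply: TensAddr.
- by move=> *; rewrite /= fZ; apply: TensScale.
Qed.

Definition tens_add (t u : tens) : tens := tens_of (repr t ++ repr u).
Definition tens_opp (t : tens) : tens := tens_of (tens_map -%R (repr t)).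
Definition tens_scale (a : A) (t : tens) : tens :=
  tens_of (tens_map ( *:%R a) (repr t)).

Lemma repr_of s : tens_eq (repr (tens_of s)) s.
Proof. by apply/tens_ofP; rewrite reprK_tens. Qed.

Lemma tens_addE s t : tens_add (tens_of s) (tens_of t) = tens_of (s ++ t).
Proof. by apply/tens_ofP; apply: TensCat; exact: repr_of. Qed.

Lemma tens_oppE s : tens_opp (tens_of s) = tens_of (tens_map -%R s).
Proof.
apply/tens_ofP; apply: tens_eq_map (repr_of s) => a m.
by rewrite scalerN.
Qed.

Lemma tens_scaleE a s :
  tens_scale a (tens_of s) = tens_of (tens_map ( *:%R a) s).
Proof.
apply/tens_ofP; apply: tens_eq_map (repr_of s) => b m.
by rewrite /= !scalerA [b * a]mulrC.
Qed.

Lemma tens_addA : associative tens_add.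
Proof.
move=> t u v; rewrite -(reprK_tens t) -(reprK_tens u) -(reprK_tens v).
by rewrite !tens_addE catA.
Qed.

Lemma tens_addC : commutative tens_add.
Proof.
move=> t u; rewrite -(reprK_tens t) -(reprK_tens u) !tens_addE.
by apply/tens_ofP; apply: TensComm.
Qed.

Lemma tens_add0 : left_id (tens_of [::]) tens_add.
Proof. by move=> t; rewrite -(reprK_tens t) tens_addE. Qed.

Lemma tens_addN : left_inverse (tens_of [::]) tens_opp tens_add.
Proof.
move=> t; rewrite -(reprK_tens t) tens_oppE tens_addE.
elim: (repr t) => [|[m n] s /tens_ofP IH] //; apply/tens_ofP => /=.
apply: (@TensTrans _ ([:: (- m, n)] ++ [:: (m, n)])); last first.
  apply: (@TensTrans _ [:: (- m + m, n)]).
    by apply: TensSym; apply: TensAddl.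
  by rewrite addNr; apply: TensZero.
apply: (@TensCat [:: _] [:: _]); first exact: TensRefl.
apply: (@TensTrans _ (([:: (m, n)] ++ s) ++ tens_map -%R s)).
  exact: TensComm.
rewrite -catA -{2}[[:: (m, n)]]cats0; apply: TensCat; first exact: TensRefl.
exact: TensTrans (TensComm _ _) IH.
Qed.

HB.instance Definition _ :=
  GRing.isZmodule.Build tens tens_addA tens_addC tens_add0 tens_addN.

Lemma tens_cat s t : tens_of (s ++ t) = tens_of s + tens_of t.
Proof. by rewrite -tens_addE. Qed.

Lemma tens_nil : tens_of [::] = 0. Proof. by []. Qed.

Lemma tens_cons m n s : tens_of ((m, n) :: s) = pure m n + tens_of s.
Proof. by rewrite -tens_cat. Qed.

Lemma tens_ind (Q : tens -> Prop) :
  Q 0 -> (forall t u, Q t -> Q u -> Q (t + u)) ->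
  (forall m n, Q (pure m n)) -> forall t, Q t.
Proof.
move=> Q0 QD Qp t; rewrite -(reprK_tens t).
elim: (repr t) => [|[m n] s IH]; first by rewrite tens_nil.
by rewrite tens_cons; apply: QD.
Qed.

Lemma pureDl m m' n : pure (m + m') n = pure m n + pure m' n.
Proof. by rewrite -tens_cat; apply/tens_ofP; apply: TensAddl. Qed.

Lemma pureDr m n n' : pure m (n + n') = pure m n + pure m n'.
Proof. by rewrite -tens_cat; apply/tens_ofP; apply: TensAddr. Qed.

Lemma pureZ a m n : pure (a *: m) n = pure m (a *: n).
Proof. by apply/tens_ofP; apply: TensScale. Qed.

Lemma tens_scalerA a b t :
  tens_scale a (tens_scale b t) = tens_scale (a * b) t.
Proof.
rewrite -(reprK_tens t) !tens_scaleE; congr tens_of.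
rewrite /tens_map -map_comp; apply: eq_map => -[m n] /=.
by rewrite scalerA.
Qed.

Lemma tens_scale1 : left_id 1 tens_scale.
Proof.
move=> t; rewrite -{2}(reprK_tens t) /tens_scale; congr tens_of.
rewrite -[RHS]map_id; apply: eq_map => -[m n] /=.
by rewrite scale1r.
Qed.

Lemma tens_scaleDr : right_distributive tens_scale +%R.
Proof.
move=> a t u; rewrite -(reprK_tens t) -(reprK_tens u).
by rewrite -[X in tens_scale _ X]tens_cat !tens_scaleE -tens_cat /tens_map map_cat.
Qed.

Lemma tens_scaleDl t : {morph tens_scale^~ t : a b / a + b}.
Proof.
move=> a b; rewrite -(reprK_tens t) !tens_scaleE.
elim: (repr t) => [|[m n] s IH] /=; first by rewrite tens_nil addr0.
by rewrite !tens_cons IH scalerDl pureDl addrACA.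
Qed.

HB.instance Definition _ := GRing.Zmodule_isLmodule.Build A tens
  tens_scalerA tens_scale1 tens_scaleDr tens_scaleDl.

Lemma scale_pure a m n : a *: pure m n = pure (a *: m) n.
Proof. exact: tens_scaleE. Qed.

Section Lift.
Variables (P : zmodType) (f : M -> N -> P).
Hypothesis fb : balanced f.

Lemma tlift_pure m n : tlift f (pure m n) = f m n.
Proof. by rewrite tlift_of // big_seq1. Qed.

Lemma tlift0 : tlift f 0 = 0.
Proof. by rewrite -tens_nil tlift_of // big_nil. Qed.

Lemma tliftD t u : tlift f (t + u) = tlift f t + tlift f u.
Proof.
rewrite -(reprK_tens t) -(reprK_tens u) -tens_cat !tlift_of //.
by rewrite big_cat.
Qed.

End Lift.

Lemma tens_ext (P : zmodType) (f g : tens -> P) :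
  (forall t u, f (t + u) = f t + f u) -> (forall t u, g (t + u) = g t + g u) ->
  (forall m n, f (pure m n) = g (pure m n)) -> f =1 g.
Proof.
move=> fD gD fg; apply: tens_ind => //.
- have z (h : tens -> P) : (forall t u, h (t + u) = h t + h u) -> h 0 = 0.
    by move=> hD; apply: (addrI (h 0)); rewrite -hD !addr0.
  by rewrite (z f fD) (z g gD).
- by move=> t u ft gu; rewrite fD gD ft gu.
Qed.

End Tensor.

Arguments tens_of {A M N}.
Arguments pure {A M N}.
Arguments tlift {A M N P}.
Arguments balanced {A M N P}.

Lemma tlift_add (A : comPzRingType) (M N : lmodType A) (P Q : zmodType)
    (f : M -> N -> P) (h : P -> Q) t :
  (forall u v, h (u + v) = h u + h v) -> h (tlift f t) =
  tlift (fun m n => h (f m n)) t.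
Proof.
move=> hD; have h0 : h 0 = 0 by apply: (addrI (h 0)); rewrite -hD !addr0.
by rewrite /tlift (big_morph h hD h0).
Qed.

Section Lift2.
Variables (A B : comPzRingType) (M N : lmodType A) (M' N' : lmodType B).
Variables (P : zmodType) (f : M -> N -> M' -> N' -> P).

Definition tlift2 (t : tens M N) (u : tens M' N') : P :=
  tlift (fun m n => tlift (f m n) u) t.

Hypothesis fb : forall m n, balanced (f m n).
Hypothesis fb' : forall m' n', balanced (fun m n => f m n m' n').

Lemma tlift2_balanced u : balanced (fun m n => tlift (f m n) u).
Proof.
split=> *; rewrite /tlift -?big_split; apply: eq_bigr => p _ /=.
- by rewrite (balDl (fb' _ _)).
- by rewrite (balDr (fb' _ _)).
- by rewrite (balZ (fb' _ _)).
Qed.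

Lemma tlift2_pure m n m' n' : tlift2 (pure m n) (pure m' n') = f m n m' n'.
Proof.
by rewrite /tlift2 tlift_pure ?tlift_pure //; apply: tlift2_balanced.
Qed.

Lemma tlift2Dl u t t' : tlift2 (t + t') u = tlift2 t u + tlift2 t' u.
Proof. by rewrite /tlift2 tliftD //; apply: tlift2_balanced. Qed.

Lemma tlift2Dr t u u' : tlift2 t (u + u') = tlift2 t u + tlift2 t u'.
Proof.
rewrite /tlift2 /tlift -big_split /=; apply: eq_bigr => p _.
exact: tliftD.
Qed.

End Lift2.

Definition pull (A B : comPzRingType) (f : {rmorphism A -> B})
  (M : lmodType B) : Type := M.

Section Pull.
Variables (A B : comPzRingType) (f : {rmorphism A -> B}) (M : lmodType B).

HB.instance Definition _ := GRing.Zmodule.on (pull f M).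

Definition pull_scale (a : A) (m : pull f M) : pull f M := f a *: (m : M).

Lemma pull_scalerA a b m :
  pull_scale a (pull_scale b m) = pull_scale (a * b) m.
Proof. by rewrite /pull_scale scalerA rmorphM. Qed.
Lemma pull_scale1 : left_id 1 pull_scale.
Proof. by move=> m; rewrite /pull_scale rmorph1 scale1r. Qed.
Lemma pull_scaleDr : right_distributive pull_scale +%R.
Proof. by move=> a m n; exact: scalerDr. Qed.
Lemma pull_scaleDl m : {morph pull_scale^~ m : a b / a + b}.
Proof. by move=> a b; rewrite /pull_scale rmorphD scalerDl. Qed.

HB.instance Definition _ := GRing.Zmodule_isLmodule.Build A (pull f M)
  pull_scalerA pull_scale1 pull_scaleDr pull_scaleDl.

End Pull.

Section TensorRing.
Variables (A B C : comPzRingType).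
Variables (f : {rmorphism A -> B}) (g : {rmorphism A -> C}).

Definition tring : Type := tens (pull f B^o) (pull g C^o).
HB.instance Definition _ := GRing.Zmodule.on tring.

Definition rpure (x : B) (y : C) : tring :=
  @pure A (pull f B^o) (pull g C^o) x y.

Definition rlift (P : zmodType) (h : B -> C -> P) (t : tring) : P :=
  @tlift A (pull f B^o) (pull g C^o) P h t.

Definition tring_mul : tring -> tring -> tring :=
  @tlift2 A A (pull f B^o) (pull g C^o) (pull f B^o) (pull g C^o) tring
    (fun x y x' y' => rpure ((x : B) * x') ((y : C) * y')).

Lemma rpureDl x x' y : rpure (x + x') y = rpure x y + rpure x' y.
Proof. exact: pureDl. Qed.
Lemma rpureDr x y y' : rpure x (y + y') = rpure x y + rpure x y'.
Proof. exact: pureDr. Qed.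
Lemma rpureZ a x y : rpure (f a * x) y = rpure x (g a * y).
Proof. exact: (@pureZ A (pull f B^o) (pull g C^o)). Qed.

Lemma rpure_ind (Q : tring -> Prop) :
  Q 0 -> (forall t u, Q t -> Q u -> Q (t + u)) ->
  (forall x y, Q (rpure x y)) -> forall t, Q t.
Proof. exact: tens_ind. Qed.

Lemma tring_balr (x : B) (y : C) :
  @balanced A (pull f B^o) (pull g C^o) tring
    (fun x' y' => rpure (x * x') (y * y')).
Proof.
split=> [x1 x2 y1|x1 y1 y2|a x1 y1].
- by rewrite mulrDr rpureDl.
- by rewrite mulrDr rpureDr.
- rewrite -[a *: x1]/(f a * x1) -[a *: y1]/(g a * y1).
  by rewrite mulrCA rpureZ mulrCA.
Qed.

Lemma tring_ball (x' : B) (y' : C) :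
  @balanced A (pull f B^o) (pull g C^o) tring
    (fun x y => rpure ((x : B) * x') ((y : C) * y')).
Proof.
split=> [x1 x2 y1|x1 y1 y2|a x1 y1].
- by rewrite mulrDl rpureDl.
- by rewrite mulrDl rpureDr.
- rewrite -[a *: x1]/(f a * x1) -[a *: y1]/(g a * y1).
  by rewrite -mulrA rpureZ mulrA.
Qed.

Lemma tring_mul_pure x y x' y' :
  tring_mul (rpure x y) (rpure x' y') = rpure (x * x') (y * y').
Proof.
exact: (@tlift2_pure A A (pull f B^o) (pull g C^o) (pull f B^o) (pull g C^o)
  tring (fun x y x' y' => rpure ((x : B) * x') ((y : C) * y')) tring_balr tring_ball).
Qed.

Lemma tring_mulDl : left_distributive tring_mul +%R.
Proof.
move=> t u v.
exact: (@tlift2Dl A A (pull f B^o) (pull g C^o) (pull f B^o) (pull g C^o)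
  tring (fun x y x' y' => rpure ((x : B) * x') ((y : C) * y')) tring_ball).
Qed.

Lemma tring_mulDr : right_distributive tring_mul +%R.
Proof.
move=> t u v.
exact: (@tlift2Dr A A (pull f B^o) (pull g C^o) (pull f B^o) (pull g C^o)
  tring (fun x y x' y' => rpure ((x : B) * x') ((y : C) * y')) tring_balr).
Qed.

Lemma tring_mul0l t : tring_mul 0 t = 0.
Proof. by apply: (addrI (tring_mul 0 t)); rewrite -tring_mulDl !addr0. Qed.
Lemma tring_mul0r t : tring_mul t 0 = 0.
Proof. by apply: (addrI (tring_mul t 0)); rewrite -tring_mulDr !addr0. Qed.

Lemma tring_mulC : commutative tring_mul.
Proof.
move=> t u; elim/rpure_ind: t => [|t t' e e'|x y].
- by rewrite tring_mul0l tring_mul0r.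
- by rewrite tring_mulDl tring_mulDr e e'.
elim/rpure_ind: u => [|u u' e e'|x' y'].
- by rewrite tring_mul0l tring_mul0r.
- by rewrite tring_mulDl tring_mulDr e e'.
by rewrite !tring_mul_pure mulrC [y * _]mulrC.
Qed.

Lemma tring_mulA : associative tring_mul.
Proof.
move=> t u v; elim/rpure_ind: t => [|t t' e e'|x y].
- by rewrite !tring_mul0l.
- by rewrite !tring_mulDl e e'.
elim/rpure_ind: u => [|u u' e e'|x' y'].
- by rewrite !(tring_mul0l, tring_mul0r).
- by rewrite !(tring_mulDl, tring_mulDr) e e'.
elim/rpure_ind: v => [|v v' e e'|x'' y''].
- by rewrite !tring_mul0r.
- by rewrite !tring_mulDr e e'.
by rewrite !tring_mul_pure !mulrA.
Qed.

Lemma tring_mul1 : left_id (rpure 1 1) tring_mul.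
Proof.
elim/rpure_ind=> [|t t' e e'|x y].
- by rewrite tring_mul0r.
- by rewrite tring_mulDr e e'.
by rewrite tring_mul_pure !mul1r.
Qed.

HB.instance Definition _ := GRing.Zmodule_isComPzRing.Build tring
  tring_mulA tring_mulC tring_mul1 tring_mulDl.

Lemma rpureM x y x' y' : rpure x y * rpure x' y' = rpure (x * x') (y * y').
Proof. exact: tring_mul_pure. Qed.

End TensorRing.

(* [gt etaL etaR M] is the tensor product of G and M over A, formed with the
   right A-module structure of G (via [etaR]); A acts on it through the left
   structure of G (via [etaL]), see [gt_scaleE]. *)
Definition gt (A G : comPzRingType) (etaL etaR : {rmorphism A -> G})
  (M : lmodType A) : Type := tens (pull etaR G^o) M.

Section LeftTensor.
Variables (A G : comPzRingType) (etaL etaR : {rmorphism A -> G}).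
Local Notation gt := (gt etaL etaR).

HB.instance Definition _ (M : lmodType A) := GRing.Zmodule.on (gt M).

Definition gpure (M : lmodType A) (x : G) (m : M) : gt M :=
  @pure A (pull etaR G^o) M x m.

Definition glift (M : lmodType A) (P : zmodType) (f : G -> M -> P) (t : gt M) :
  P := @tlift A (pull etaR G^o) M P f t.

Definition gact (M : lmodType A) (x : G) : gt M -> gt M :=
  glift (fun y m => gpure (x * y) m).

Lemma gpureDl (M : lmodType A) x x' (m : M) : gpure (x + x') m = gpure x m + gpure x' m.
Proof. exact: pureDl. Qed.
Lemma gpureDr (M : lmodType A) x (m m' : M) : gpure x (m + m') = gpure x m + gpure x m'.
Proof. exact: pureDr. Qed.
Lemma gpureZ (M : lmodType A) a x (m : M) : gpure (etaR a * x) m = gpure x (a *: m).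
Proof. exact: (@pureZ A (pull etaR G^o) M). Qed.

Lemma gt_ind (M : lmodType A) (Q : gt M -> Prop) :
  Q 0 -> (forall t u, Q t -> Q u -> Q (t + u)) ->
  (forall x m, Q (gpure x m)) -> forall t, Q t.
Proof. exact: tens_ind. Qed.

Lemma gt_ext (M : lmodType A) (P : zmodType) (f g : gt M -> P) :
  (forall t u, f (t + u) = f t + f u) -> (forall t u, g (t + u) = g t + g u) ->
  (forall x m, f (gpure x m) = g (gpure x m)) -> f =1 g.
Proof. exact: tens_ext. Qed.

Definition gbalanced (M : lmodType A) (P : zmodType) (f : G -> M -> P) :=
  @balanced A (pull etaR G^o) M P f.

Lemma gbal (M : lmodType A) (P : zmodType) (f : G -> M -> P) :
  (forall x x' m, f (x + x') m = f x m + f x' m) ->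
  (forall x m m', f x (m + m') = f x m + f x m') ->
  (forall a x m, f (etaR a * x) m = f x (a *: m)) -> gbalanced f.
Proof. by move=> *; split. Qed.

Lemma glift_pure (M : lmodType A) (P : zmodType) (f : G -> M -> P) x m :
  gbalanced f -> glift f (gpure x m) = f x m.
Proof. by move=> fb; apply: tlift_pure. Qed.

Lemma gliftD (M : lmodType A) (P : zmodType) (f : G -> M -> P) t u :
  gbalanced f -> glift f (t + u) = glift f t + glift f u.
Proof. by move=> fb; apply: tliftD. Qed.

Lemma gact_balanced (M : lmodType A) x :
  gbalanced (fun y (m : M) => gpure (x * y) m).
Proof.
split=> *; first by rewrite mulrDr gpureDl.
- by rewrite gpureDr.
- by rewrite -gpureZ mulrCA.
Qed.

Lemma gact_pure (M : lmodType A) x y (m : M) :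
  gact x (gpure y m) = gpure (x * y) m.
Proof. by apply: glift_pure; apply: gact_balanced. Qed.

Lemma gactD (M : lmodType A) x (t u : gt M) :
  gact x (t + u) = gact x t + gact x u.
Proof. by apply: gliftD; apply: gact_balanced. Qed.

Lemma gact0 (M : lmodType A) x : gact x (0 : gt M) = 0.
Proof. by apply: (addrI (gact x 0)); rewrite -gactD !addr0. Qed.

Lemma gactA (M : lmodType A) x y (t : gt M) :
  gact x (gact y t) = gact (x * y) t.
Proof.
elim/gt_ind: t => [|t t' e e'|z m]; first by rewrite !gact0.
- by rewrite !gactD e e'.
- by rewrite !gact_pure mulrA.
Qed.

Lemma gact1 (M : lmodType A) (t : gt M) : gact 1 t = t.
Proof.
elim/gt_ind: t => [|t t' e e'|z m]; first by rewrite gact0.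
- by rewrite gactD e e'.
- by rewrite gact_pure mul1r.
Qed.

Lemma gactDl (M : lmodType A) x y (t : gt M) :
  gact (x + y) t = gact x t + gact y t.
Proof.
elim/gt_ind: t => [|t t' e e'|z m]; first by rewrite !gact0 addr0.
- by rewrite !gactD e e' addrACA.
- by rewrite !gact_pure mulrDl gpureDl.
Qed.

Definition gt_scale (M : lmodType A) (a : A) (t : gt M) : gt M :=
  gact (etaL a) t.

Lemma gt_scalerA M a b (t : gt M) :
  gt_scale a (gt_scale b t) = gt_scale (a * b) t.
Proof. by rewrite /gt_scale gactA rmorphM. Qed.
Lemma gt_scale1 M : left_id 1 (@gt_scale M).
Proof. by move=> t; rewrite /gt_scale rmorph1 gact1. Qed.
Lemma gt_scaleDr M : right_distributive (@gt_scale M) +%R.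
Proof. by move=> a t u; exact: gactD. Qed.
Lemma gt_scaleDl M (t : gt M) : {morph (@gt_scale M)^~ t : a b / a + b}.
Proof. by move=> a b; rewrite /gt_scale rmorphD gactDl. Qed.

HB.instance Definition _ (M : lmodType A) :=
  GRing.Zmodule_isLmodule.Build A (gt M) (@gt_scalerA M) (@gt_scale1 M)
    (@gt_scaleDr M) (@gt_scaleDl M).

Lemma gt_scaleE (M : lmodType A) a (t : gt M) : a *: t = gact (etaL a) t.
Proof. by []. Qed.

Definition gmap (M N : lmodType A) (f : M -> N) : gt M -> gt N :=
  glift (fun x m => gpure x (f m)).

End LeftTensor.

Arguments gpure {A G etaL etaR M}.
Arguments glift {A G etaL etaR M P}.
Arguments gact {A G etaL etaR M}.
Arguments gmap {A G etaL etaR M N}.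

(* The composite of D (x) M : G (x) M -> (G (x) G) (x) M with the associativity
   isomorphism onto G (x) (G (x) M), all tensor products being over A. *)
Definition gassoc (A G : comPzRingType) (etaL etaR : {rmorphism A -> G})
    (D : G -> tring etaR etaL) (M : lmodType A) :
    gt etaL etaR M -> gt etaL etaR (gt etaL etaR M) :=
  glift (fun x m =>
    glift (fun y (z : pull etaL G^o) => gpure y (gpure (z : G) m))
      (D x : gt etaL etaR (pull etaL G^o))).

Arguments gassoc {A G etaL etaR} D {M}.

(* [etaL] and [etaR] corepresent source and target; G (x) G corepresents the
   pairs (f, g) with target f = source g, and [Delta] their composition. The
   maps under [rlift] are balanced because of the axioms [epsL] to [chiR]. The
   identity chi (chi x) = x follows, as inverses in a groupoid are unique. *)
Record hopf_algebroid (k : comPzRingType) := HopfAlgebroid {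
  hA : comPzRingType;
  hG : comPzRingType;
  unitA : {rmorphism k -> hA};
  unitG : {rmorphism k -> hG};
  etaL : {rmorphism hA -> hG};
  etaR : {rmorphism hA -> hG};
  eps : {rmorphism hG -> hA};
  chi : {rmorphism hG -> hG};
  Delta : {rmorphism hG -> tring etaR etaL};
  etaL_unit : forall c, etaL (unitA c) = unitG c;
  etaR_unit : forall c, etaR (unitA c) = unitG c;
  eps_unit : forall c, eps (unitG c) = unitA c;
  chi_unit : forall c, chi (unitG c) = unitG c;
  Delta_unit : forall c, Delta (unitG c) = rpure etaR etaL (unitG c) 1;
  epsL : forall a, eps (etaL a) = a;
  epsR : forall a, eps (etaR a) = a;
  chiL : forall a, chi (etaL a) = etaR a;
  chiR : forall a, chi (etaR a) = etaL a;
  DeltaL : forall a, Delta (etaL a) = rpure etaR etaL (etaL a) 1;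
  DeltaR : forall a, Delta (etaR a) = rpure etaR etaL 1 (etaR a);
  Delta_counitL : forall x,
    rlift (fun y z : hG => etaL (eps y) * z) (Delta x) = x;
  Delta_counitR : forall x,
    rlift (fun y z : hG => y * etaR (eps z)) (Delta x) = x;
  Delta_coassoc : forall x,
    gassoc Delta (Delta x : gt etaL etaR (pull etaL hG^o)) =
    gmap (Delta : pull etaL hG^o -> gt etaL etaR (pull etaL hG^o)) (Delta x);
  Delta_invL : forall x,
    rlift (fun y z : hG => chi y * z) (Delta x) = etaR (eps x);
  Delta_invR : forall x,
    rlift (fun y z : hG => y * chi z) (Delta x) = etaL (eps x)
}.

Definition gten (k : comPzRingType) (H : hopf_algebroid k) (M : lmodType (hA H)) :
  lmodType (hA H) := gt (etaL H) (etaR H) M.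
Arguments gten {k} H M.

Definition flat_module (A : comPzRingType) (X : lmodType A) : Prop :=
  forall (P Q : lmodType A) (f : {linear P -> Q}), injective f ->
  injective (tlift (fun (x : X) p => pure x (f p)) : tens X P -> tens X Q).

Definition flat (k : comPzRingType) (H : hopf_algebroid k) : Prop :=
  flat_module (pull (etaR H) (hG H)^o).

Section Comodules.
Variables (k : comPzRingType) (H : hopf_algebroid k).
Local Notation A := (hA H).
Local Notation G := (hG H).
Local Notation GT := (gten H).
Local Notation gassoc := (gassoc (Delta H)).

Definition gcounit (M : lmodType A) : GT M -> M :=
  glift (fun x m => eps H x *: m).

Record comodule := Comodule {
  csort :> lmodType A;
  coact : {linear csort -> GT csort};
  coact_counit : forall m, gcounit (coact m) = m;
  coact_coassoc : forall m, gassoc (coact m) = gmap coact (coact m)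
}.

Record comod_hom (M N : comodule) := ComodHom {
  hom_fun :> {linear M -> N};
  hom_coact : forall m, coact N (hom_fun m) = gmap hom_fun (coact M m)
}.

Lemma comod_hom_ext (M N : comodule) (f g : comod_hom M N) : f =1 g -> f = g.
Proof.
case: f => f fP; case: g => g gP /= /lin_ext e.
by case: _ / e gP => gP; rewrite (Prop_irrelevance fP gP).
Qed.

Implicit Types (M N P Q : lmodType A).

Lemma gmap_balanced M N (f : {linear M -> N}) :
  @gbalanced A G (etaR H) M (GT N) (fun x m => gpure x (f m)).
Proof.
apply: gbal => *; first by rewrite gpureDl.
- by rewrite linearD gpureDr.
- by rewrite gpureZ linearZ.
Qed.

Lemma gmap_pure M N (f : {linear M -> N}) x m :
  gmap f (gpure x m : GT M) = gpure x (f m) :> GT N.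
Proof. exact/glift_pure/gmap_balanced. Qed.

Lemma gmapD M N (f : {linear M -> N}) (t u : GT M) :
  gmap f (t + u) = gmap f t + gmap f u :> GT N.
Proof. exact/gliftD/gmap_balanced. Qed.

Lemma gmap0 M N (f : {linear M -> N}) : gmap f (0 : GT M) = 0 :> GT N.
Proof. by apply: (addrI (gmap f (0 : GT M))); rewrite -gmapD !addr0. Qed.

Lemma gmap_act M N (f : {linear M -> N}) x (t : GT M) :
  gmap f (gact x t) = gact x (gmap f t) :> GT N.
Proof.
elim/gt_ind: t => [|t t' e e'|y m].
- by rewrite !(gact0, gmap0).
- by rewrite !(gactD, gmapD) e e'.
- by rewrite !(gact_pure, gmap_pure).
Qed.

Lemma gmap_linear M N (f : {linear M -> N}) :
  linear (gmap f : GT M -> GT N).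
Proof. by move=> a t u; rewrite gmapD !gt_scaleE gmap_act. Qed.

Definition gmapl M N (f : {linear M -> N}) : {linear GT M -> GT N} :=
  mklin (gmap_linear f).

Lemma gmap_comp M N P (f : {linear M -> N}) (g : {linear N -> P}) (t : GT M) :
  gmap g (gmap f t : GT N) = gmap (g \o f) t :> GT P.
Proof.
elim/gt_ind: t => [|t t' e e'|y m].
- by rewrite !gmap0.
- by rewrite !gmapD e e'.
- by rewrite !gmap_pure.
Qed.

Lemma gmap_id M (t : GT M) : gmap (fun m => m) t = t.
Proof.
elim/gt_ind: t => [|t t' e e'|y m].
- exact: (@gmap0 _ _ idfun).
- by rewrite (@gmapD _ _ idfun) e e'.
- exact: (@gmap_pure _ _ idfun).
Qed.

Lemma eq_gmap M N (f g : M -> N) : f =1 g -> gmap f =1 (gmap g : GT M -> GT N).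
Proof. by move=> /funext ->. Qed.

Lemma gcounit_balanced M : @gbalanced A G (etaR H) M M (fun x m => eps H x *: m).
Proof.
apply: gbal => *.
- by rewrite rmorphD scalerDl.
- by rewrite scalerDr.
- by rewrite rmorphM epsR mulrC scalerA.
Qed.

Lemma gcounit_pure M x (m : M) : gcounit (gpure x m) = eps H x *: m.
Proof. exact/glift_pure/gcounit_balanced. Qed.
Lemma gcounitD M (t u : GT M) : gcounit (t + u) = gcounit t + gcounit u.
Proof. exact/gliftD/gcounit_balanced. Qed.
Lemma gcounit0 M : gcounit (0 : GT M) = 0.
Proof. by apply: (addrI (gcounit (0 : GT M))); rewrite -gcounitD !addr0. Qed.
Lemma gcounit_act M x (t : GT M) : gcounit (gact x t) = eps H x *: gcounit t.
Proof.
elim/gt_ind: t => [|t t' e e'|y m].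
- by rewrite gact0 gcounit0 scaler0.
- by rewrite gactD !gcounitD scalerDr e e'.
- by rewrite gact_pure !gcounit_pure scalerA rmorphM.
Qed.
Lemma gcounit_linear M : linear (@gcounit M).
Proof. by move=> a t u; rewrite gcounitD gt_scaleE gcounit_act epsL. Qed.
Definition gcounitl M : {linear GT M -> M} := mklin (@gcounit_linear M).

Lemma gcounit_map M N (f : {linear M -> N}) (t : GT M) :
  gcounit (gmap f t : GT N) = f (gcounit t).
Proof.
elim/gt_ind: t => [|t t' e e'|y m].
- by rewrite gmap0 !gcounit0 linear0.
- by rewrite gmapD !gcounitD linearD e e'.
- by rewrite gmap_pure !gcounit_pure linearZ.
Qed.

Let GL : lmodType A := pull (etaL H) G^o.

Definition dins M (m : M) : GT GL -> GT (GT M) :=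
  glift (fun y (z : GL) => gpure y (gpure (z : G) m)).

Lemma dins_balanced M (m : M) : @gbalanced A G (etaR H) GL (GT (GT M))
  (fun y z => gpure y (gpure (z : G) m)).
Proof.
apply: gbal => [x x' z|x z z'|a x z].
- by rewrite gpureDl.
- by rewrite gpureDl gpureDr.
- rewrite gpureZ gt_scaleE gact_pure; congr (gpure _ _).
Qed.

Lemma dins_pure M (m : M) y (z : G) :
  dins m (gpure y (z : GL)) = gpure y (gpure z m).
Proof. exact/glift_pure/dins_balanced. Qed.
Lemma dinsD M (m : M) (t u : GT GL) : dins m (t + u) = dins m t + dins m u.
Proof. exact/gliftD/dins_balanced. Qed.
Lemma dins0 M (m : M) : dins m (0 : GT GL) = 0.
Proof. by apply: (addrI (dins m (0 : GT GL))); rewrite -dinsD !addr0. Qed.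
Lemma dinsDr M (m m' : M) (t : GT GL) : dins (m + m') t = dins m t + dins m' t.
Proof.
elim/gt_ind: t => [|t t' e e'|y z].
- by rewrite !dins0 addr0.
- by rewrite !dinsD e e' addrACA.
- by rewrite !dins_pure !gpureDr.
Qed.

Lemma gassoc_balanced M : @gbalanced A G (etaR H) M (GT (GT M))
  (fun x m => dins m (Delta H x : GT GL)).
Proof.
apply: gbal => [x x' m|x m m'|a x m].
- by rewrite rmorphD dinsD.
- exact: dinsDr.
- rewrite rmorphM DeltaR; move: (Delta H x) => t.
  elim/(@rpure_ind _ _ _ (etaR H) (etaL H)): t => [|t t' e e'|y z].
  + by rewrite mulr0 !dins0.
  + by rewrite mulrDr !dinsD e e'.
  + rewrite rpureM mul1r [LHS]dins_pure [RHS]dins_pure.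
    by rewrite gpureZ.
Qed.

Lemma gassoc_pure M x (m : M) :
  gassoc (gpure x m : GT M) = dins m (Delta H x : GT GL).
Proof. exact/glift_pure/gassoc_balanced. Qed.
Lemma gassocD M (t u : GT M) :
  gassoc (t + u) = gassoc t + gassoc u :> GT (GT M).
Proof. exact/gliftD/gassoc_balanced. Qed.
Lemma gassoc0 M : gassoc (0 : GT M) = 0 :> GT (GT M).
Proof. by apply: (addrI (gassoc (0 : GT M))); rewrite -gassocD !addr0. Qed.

Lemma gassoc_map M N (f : {linear M -> N}) (t : GT M) :
  gassoc (gmap f t : GT N) = gmap (gmapl f) (gassoc t) :> GT (GT N).
Proof.
elim/gt_ind: t => [|t t' e e'|x m].
- by rewrite !(gmap0, gassoc0).
- by rewrite !(gmapD, gassocD) e e'.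
rewrite gmap_pure !gassoc_pure; move: (Delta H x : GT GL) => t.
elim/gt_ind: t => [|t t' e e'|y z].
- by rewrite !dins0 gmap0.
- by rewrite !(dinsD, gmapD) e e'.
- by rewrite !dins_pure gmap_pure /= gmap_pure.
Qed.

Lemma gassoc_act M x (t : GT M) a : x = etaL H a ->
  gassoc (gact x t) = gact x (gassoc t) :> GT (GT M).
Proof.
move=> ->; elim/gt_ind: t => [|t t' e e'|y m].
- by rewrite !(gact0, gassoc0).
- by rewrite !(gactD, gassocD) e e'.
rewrite gact_pure !gassoc_pure rmorphM DeltaL; move: (Delta H y) => t.
elim/(@rpure_ind _ _ _ (etaR H) (etaL H)): t => [|t t' e e'|u v].
- by rewrite mulr0 dins0 gact0.
- by rewrite mulrDr !dinsD gactD e e'.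
- rewrite rpureM mul1r [in LHS]dins_pure.
  by rewrite [dins m _]dins_pure gact_pure.
Qed.

Lemma gassoc_linear M : linear (gassoc : GT M -> GT (GT M)).
Proof. by move=> a t u; rewrite gassocD !gt_scaleE (gassoc_act _ erefl). Qed.
Definition gassocl M : {linear GT M -> GT (GT M)} := mklin (@gassoc_linear M).

Lemma gassoc_counit M (t : GT M) : gcounit (gassoc t : GT (GT M)) = t.
Proof.
elim/gt_ind: t => [|t t' e e'|x m].
- by rewrite gassoc0 gcounit0.
- by rewrite gassocD gcounitD e e'.
rewrite gassoc_pure -{2}[x](Delta_counitL x).
rewrite /rlift (@tlift_add _ _ _ _ _ _ (fun y => gpure y m : GT M)); last first.
  by move=> *; rewrite gpureDl.
move: (Delta H x : GT GL) => t.
have bal : @gbalanced A G (etaR H) GL (GT M)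
    (fun y z => gpure (etaL H (eps H y) * z) m).
  apply: gbal => [y y' z|y z z'|a y z].
  - by rewrite !rmorphD mulrDl gpureDl.
  - by rewrite mulrDr gpureDl.
  - by rewrite !rmorphM epsR -mulrA mulrCA.
elim/gt_ind: t => [|t t' e e'|y z].
- by rewrite dins0 gcounit0 tlift0.
- by rewrite dinsD gcounitD [RHS]tliftD // e e'.
- by rewrite dins_pure gcounit_pure [RHS]tlift_pure // gt_scaleE gact_pure.
Qed.

Lemma gassoc_mapcounit M (t : GT M) :
  gmap (@gcounitl M) (gassoc t : GT (GT M)) = t.
Proof.
elim/gt_ind: t => [|t t' e e'|x m].
- by rewrite gassoc0 gmap0.
- by rewrite gassocD gmapD e e'.
rewrite gassoc_pure -{2}[x](Delta_counitR x).
rewrite /rlift (@tlift_add _ _ _ _ _ _ (fun y => gpure y m : GT M)); last first.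
  by move=> *; rewrite gpureDl.
move: (Delta H x : GT GL) => t.
have bal : @gbalanced A G (etaR H) GL (GT M)
    (fun y z => gpure (y * etaR H (eps H z)) m).
  apply: gbal => [y y' z|y z z'|a y z].
  - by rewrite mulrDl gpureDl.
  - by rewrite !rmorphD mulrDr gpureDl.
  - rewrite -[a *: z]/(etaL H a * z) !rmorphM epsL.
    by rewrite mulrA [y * _]mulrC.
elim/gt_ind: t => [|t t' e e'|y z].
- by rewrite dins0 gmap0 tlift0.
- by rewrite dinsD gmapD [RHS]tliftD // e e'.
- rewrite dins_pure gmap_pure /= gcounit_pure [RHS]tlift_pure //.
  by rewrite -gpureZ mulrC.
Qed.

Definition ginsm M (m : M) : GL -> GT M := fun z => gpure (z : G) m.
Lemma ginsm_linear M (m : M) : linear (ginsm m).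
Proof.
by move=> a z z'; rewrite /ginsm gpureDl gt_scaleE gact_pure.
Qed.

Lemma dinsE M (m : M) (t : GT GL) : dins m t = gmap (mklin (ginsm_linear m)) t.
Proof. by []. Qed.

Lemma Delta_linear : linear (Delta H : GL -> GT GL).
Proof.
move=> a x y; rewrite rmorphD; congr (_ + _).
rewrite -[a *: x]/(etaL H a * x) rmorphM DeltaL gt_scaleE.
move: (Delta H x) => t.
elim/(@rpure_ind _ _ _ (etaR H) (etaL H)): t => [|t t' e e'|u v].
- by rewrite mulr0 gact0.
- by rewrite mulrDr gactD e e'.
- by rewrite rpureM mul1r [RHS]gact_pure.
Qed.

Lemma gassoc_assoc M (t : GT M) :
  gassoc (gassoc t : GT (GT M)) = gmap (@gassocl M) (gassoc t)
    :> GT (GT (GT M)).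
Proof.
elim/gt_ind: t => [|t t' e e'|x m].
- by rewrite !(gassoc0, gmap0).
- by rewrite !(gassocD, gmapD) e e'.
rewrite gassoc_pure dinsE gassoc_map gmap_comp.
have -> : gassoc (Delta H x : GT GL) =
    gmap (mklin Delta_linear) (Delta H x : GT GL) :> GT (GT GL).
  exact: Delta_coassoc.
rewrite gmap_comp; apply: eq_gmap => z /=.
by rewrite [RHS]gassoc_pure dinsE.
Qed.

End Comodules.

Section TensorLinear.
Variable A : comPzRingType.
Implicit Types M N P Q : lmodType A.

Lemma tliftl_linear M N P (f : M -> N -> P) : balanced f ->
  (forall a m n, f (a *: m) n = a *: f m n) -> linear (tlift f).
Proof.
move=> fb fZ a t u; rewrite tliftD //; congr (_ + _).
elim/tens_ind: t => [|t t' e e'|m n].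
- by rewrite scaler0 tlift0 // scaler0.
- by rewrite scalerDr !tliftD // e e' scalerDr.
- by rewrite scale_pure !tlift_pure.
Qed.

Definition tmap M N P Q (f : M -> P) (g : N -> Q) : tens M N -> tens P Q :=
  tlift (fun m n => pure (f m) (g n)).

Lemma tmap_balanced M N P Q (f : {linear M -> P}) (g : {linear N -> Q}) :
  balanced (fun m n => pure (f m) (g n)).
Proof.
split=> *.
- by rewrite linearD pureDl.
- by rewrite linearD pureDr.
- by rewrite !linearZ pureZ.
Qed.

Lemma tmap_linear M N P Q (f : {linear M -> P}) (g : {linear N -> Q}) :
  linear (tmap f g).
Proof.
apply: tliftl_linear; first exact: tmap_balanced.
by move=> *; rewrite linearZ scale_pure.
Qed.

Definition tmapl M N P Q (f : {linear M -> P}) (g : {linear N -> Q}) :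
  {linear tens M N -> tens P Q} := mklin (tmap_linear f g).

Lemma tmap0 M N P Q (f : {linear M -> P}) (g : {linear N -> Q}) :
  tmap f g 0 = 0.
Proof. exact: (linear0 (tmapl f g)). Qed.
Lemma tmapD M N P Q (f : {linear M -> P}) (g : {linear N -> Q}) t u :
  tmap f g (t + u) = tmap f g t + tmap f g u.
Proof. exact: (linearD (tmapl f g)). Qed.
Lemma tmapN M N P Q (f : {linear M -> P}) (g : {linear N -> Q}) t :
  tmap f g (- t) = - tmap f g t.
Proof. exact: (linearN (tmapl f g)). Qed.

Lemma tmap_pure M N P Q (f : {linear M -> P}) (g : {linear N -> Q}) m n :
  tmap f g (pure m n) = pure (f m) (g n).
Proof. exact/tlift_pure/tmap_balanced. Qed.

Lemma tmapl_pure M N P Q (f : {linear M -> P}) (g : {linear N -> Q}) m n :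
  tmapl f g (pure m n) = pure (f m) (g n).
Proof. exact: tmap_pure. Qed.

Lemma lin_tens_ext M N P (f g : {linear tens M N -> P}) :
  (forall m n, f (pure m n) = g (pure m n)) -> f =1 g.
Proof. by move=> h; apply: tens_ext => //; apply: linearD. Qed.

End TensorLinear.

Section Monoidal.
Variables (k : comPzRingType) (H : hopf_algebroid k).
Local Notation A := (hA H).
Local Notation G := (hG H).
Local Notation GT := (gten H).
Local Notation gassoc := (gassoc (Delta H)).
Implicit Types (M N P Q : lmodType A).

(* (x (x) m, y (x) n) |-> xy (x) (m (x) n) *)
Definition gmul M N : GT M -> GT N -> GT (tens M N) :=
  @tlift2 A A (pull (etaR H) G^o) M (pull (etaR H) G^o) N (GT (tens M N))
    (fun (x : G) m (y : G) n => gpure (x * y) (pure m n)).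

Lemma gmul_balr M N (x : G) (m : M) :
  @balanced A (pull (etaR H) G^o) N (GT (tens M N))
    (fun y n => gpure (x * (y : G)) (pure m n)).
Proof.
split=> [y y' n|y n n'|a y n].
- by rewrite mulrDr gpureDl.
- by rewrite pureDr gpureDr.
- rewrite -[a *: y]/(etaR H a * y) mulrCA gpureZ scale_pure.
  by rewrite pureZ.
Qed.

Lemma gmul_ball M N (y : G) (n : N) :
  @balanced A (pull (etaR H) G^o) M (GT (tens M N))
    (fun x m => gpure ((x : G) * y) (pure m n)).
Proof.
split=> [x x' m|x m m'|a x m].
- by rewrite mulrDl gpureDl.
- by rewrite pureDl gpureDr.
- by rewrite -[a *: x]/(etaR H a * x) -mulrA gpureZ scale_pure.
Qed.

Lemma gmul_pure M N x (m : M) y (n : N) :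
  gmul (gpure x m) (gpure y n) = gpure (x * y) (pure m n).
Proof.
exact: (@tlift2_pure A A (pull (etaR H) G^o) M (pull (etaR H) G^o) N
  (GT (tens M N)) (fun (x : G) m (y : G) n => gpure (x * y) (pure m n))
  (@gmul_balr M N) (@gmul_ball M N)).
Qed.

Lemma gmulDl M N (u u' : GT M) (v : GT N) :
  gmul (u + u') v = gmul u v + gmul u' v.
Proof.
exact: (@tlift2Dl A A (pull (etaR H) G^o) M (pull (etaR H) G^o) N
  (GT (tens M N)) (fun (x : G) m (y : G) n => gpure (x * y) (pure m n))
  (@gmul_ball M N)).
Qed.

Lemma gmulDr M N (u : GT M) (v v' : GT N) :
  gmul u (v + v') = gmul u v + gmul u v'.
Proof.
exact: (@tlift2Dr A A (pull (etaR H) G^o) M (pull (etaR H) G^o) N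
  (GT (tens M N)) (fun (x : G) m (y : G) n => gpure (x * y) (pure m n))
  (@gmul_balr M N)).
Qed.

Lemma gmul0l M N (v : GT N) : gmul (0 : GT M) v = 0.
Proof. by apply: (addrI (gmul (0 : GT M) v)); rewrite -gmulDl !addr0. Qed.
Lemma gmul0r M N (u : GT M) : gmul u (0 : GT N) = 0.
Proof. by apply: (addrI (gmul u (0 : GT N))); rewrite -gmulDr !addr0. Qed.

Lemma gmul_actl M N x (u : GT M) (v : GT N) :
  gmul (gact x u) v = gact x (gmul u v).
Proof.
elim/gt_ind: u => [|u u' e e'|y m].
- by rewrite !(gact0, gmul0l).
- by rewrite !(gactD, gmulDl) e e'.
elim/gt_ind: v => [|v v' e e'|z n].
- by rewrite !(gact0, gmul0r).
- by rewrite !(gactD, gmulDr) e e'.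
- by rewrite !(gact_pure, gmul_pure) mulrA.
Qed.

Lemma gmul_actr M N x (u : GT M) (v : GT N) :
  gmul u (gact x v) = gact x (gmul u v).
Proof.
elim/gt_ind: u => [|u u' e e'|y m].
- by rewrite !(gact0, gmul0l).
- by rewrite !(gactD, gmulDl) e e'.
elim/gt_ind: v => [|v v' e e'|z n].
- by rewrite !(gact0, gmul0r).
- by rewrite !(gactD, gmulDr) e e'.
- by rewrite !(gact_pure, gmul_pure) mulrCA.
Qed.

Lemma gmul_balanced M N : balanced (@gmul M N).
Proof.
split=> *; first exact: gmulDl.
- exact: gmulDr.
- by rewrite !gt_scaleE gmul_actl gmul_actr.
Qed.

Lemma smash_g_linear M N : linear (tlift (@gmul M N)).
Proof.
apply: tliftl_linear; first exact: gmul_balanced.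
by move=> *; rewrite !gt_scaleE gmul_actl.
Qed.

(* The map g from (G (x) M) (x) (G (x) N) to G (x) (M (x) N). *)
Definition smash_g M N : {linear tens (GT M) (GT N) -> GT (tens M N)} :=
  mklin (@smash_g_linear M N).

Lemma smash_g_pure M N (u : GT M) (v : GT N) :
  smash_g M N (pure u v) = gmul u v.
Proof. exact/tlift_pure/gmul_balanced. Qed.

Lemma gmul_map M N P Q (f : {linear M -> P}) (g : {linear N -> Q})
    (u : GT M) (v : GT N) :
  gmul (gmap f u : GT P) (gmap g v : GT Q) = gmap (tmapl f g) (gmul u v).
Proof.
elim/gt_ind: u => [|u u' e e'|x m].
- by rewrite gmap0 !gmul0l gmap0.
- by rewrite gmapD !gmulDl gmapD e e'.
elim/gt_ind: v => [|v v' e e'|y n].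
- by rewrite gmap0 !gmul0r gmap0.
- by rewrite gmapD !gmulDr gmapD e e'.
- by rewrite !gmap_pure !gmul_pure gmap_pure /= tmap_pure.
Qed.

Lemma gcounit_mul M N (u : GT M) (v : GT N) :
  gcounit (gmul u v) = pure (gcounit u) (gcounit v).
Proof.
have p0 (n : N) : pure (0 : M) n = 0.
  by apply: (addrI (pure 0 n)); rewrite -pureDl !addr0.
have p0' (m : M) : pure m (0 : N) = 0.
  by apply: (addrI (pure m 0)); rewrite -pureDr !addr0.
elim/gt_ind: u => [|u u' e e'|x m].
- by rewrite gmul0l !gcounit0 p0.
- by rewrite gmulDl !gcounitD e e' pureDl.
elim/gt_ind: v => [|v v' e e'|y n].
- by rewrite gmul0r !gcounit0 p0'.
- by rewrite gmulDr !gcounitD e e' pureDr.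
- by rewrite gmul_pure !gcounit_pure scale_pure -pureZ scalerA rmorphM mulrC.
Qed.

Lemma gassoc_mul M N (u : GT M) (v : GT N) :
  gassoc (gmul u v) = gmap (smash_g M N) (gmul (gassoc u) (gassoc v))
    :> GT (GT (tens M N)).
Proof.
elim/gt_ind: u => [|u u' e e'|x m].
- by rewrite gmul0l !gassoc0 gmul0l gmap0.
- by rewrite gmulDl !gassocD gmulDl gmapD e e'.
elim/gt_ind: v => [|v v' e e'|y n].
- by rewrite gmul0r !gassoc0 gmul0r gmap0.
- by rewrite gmulDr !gassocD gmulDr gmapD e e'.
rewrite gmul_pure !gassoc_pure rmorphM; move: (Delta H x) (Delta H y) => s t.
elim/(@rpure_ind _ _ _ (etaR H) (etaL H)): s => [|s s' e e'|x1 x2].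
- by rewrite mul0r !dins0 gmul0l gmap0.
- by rewrite mulrDl !dinsD gmulDl gmapD e e'.
elim/(@rpure_ind _ _ _ (etaR H) (etaL H)): t => [|t t' e e'|y1 y2].
- by rewrite mulr0 !dins0 gmul0r gmap0.
- by rewrite mulrDr !dinsD gmulDr gmapD e e'.
rewrite rpureM [LHS]dins_pure [dins m _]dins_pure [dins n _]dins_pure.
by rewrite gmul_pure gmap_pure smash_g_pure gmul_pure.
Qed.

Section Smash.
Variables M N : comodule H.

Definition smash_coact : {linear tens M N -> GT (tens M N)} :=
  smash_g M N \o tmapl (coact M) (coact N).

Lemma smash_coact_pure m n :
  smash_coact (pure m n) = gmul (coact M m) (coact N n).
Proof.
by rewrite -smash_g_pure -(tmap_pure (coact M) (coact N)).
Qed.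

Lemma smash_counit t : gcounit (smash_coact t) = t.
Proof.
move: t; apply: tens_ext => // [t u|m n]; first by rewrite linearD gcounitD.
by rewrite smash_coact_pure gcounit_mul !coact_counit.
Qed.

Lemma smash_coassoc t :
  gassoc (smash_coact t) = gmap smash_coact (smash_coact t)
    :> GT (GT (tens M N)).
Proof.
move: t; apply: tens_ext => [t u|t u|m n].
- by rewrite linearD gassocD.
- by rewrite linearD gmapD.
rewrite smash_coact_pure gassoc_mul !coact_coassoc gmul_map gmap_comp.
exact: eq_gmap.
Qed.

Definition smash : comodule H :=
  Comodule (csort := tens M N) smash_counit smash_coassoc.

Lemma coact_smash m n :
  coact smash (pure m n) = gmul (coact M m) (coact N n).
Proof. exact: smash_coact_pure. Qed.

End Smash.

Lemma unit_coact_linear : linear (fun a : A^o => gpure (etaL H a) (1 : A^o) : GT A^o).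
Proof.
move=> a x y; rewrite rmorphD gpureDl; congr (_ + _).
by rewrite gt_scaleE gact_pure -[a *: x]/(a * x) rmorphM.
Qed.

Definition unit_coact : {linear A^o -> GT A^o} := mklin unit_coact_linear.

Lemma unit_counit (a : A^o) : gcounit (unit_coact a) = a.
Proof. by rewrite gcounit_pure epsL -[_ *: _]/(a * 1) mulr1. Qed.

Lemma unit_coassoc (a : A^o) :
  gassoc (unit_coact a) = gmap unit_coact (unit_coact a) :> GT (GT A^o).
Proof.
by rewrite gassoc_pure gmap_pure DeltaL [LHS]dins_pure /= rmorph1.
Qed.

(* The coaction is [etaL], through G = G (x) A. *)
Definition unit_comod : comodule H :=
  Comodule (csort := A^o) unit_counit unit_coassoc.

Lemma id_coact (M : comodule H) m :
  coact M (idfun m) = gmap idfun (coact M m).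
Proof. by rewrite gmap_id. Qed.

Definition comod_id (M : comodule H) : comod_hom M M :=
  ComodHom (hom_fun := idfun) (@id_coact M).

Lemma comp_coact (M N P : comodule H) (g : comod_hom N P) (f : comod_hom M N) m :
  coact P ((g \o f) m) = gmap (g \o f) (coact M m).
Proof. by rewrite /= !hom_coact gmap_comp. Qed.

Definition comod_comp (M N P : comodule H) (g : comod_hom N P)
  (f : comod_hom M N) : comod_hom M P := ComodHom (comp_coact g f).

Definition comod_iso (M N : comodule H) (f : comod_hom M N) : Prop :=
  exists g : comod_hom N M, cancel f g /\ cancel g f.

Lemma smash_map_coact (M N P Q : comodule H) (f : comod_hom M P)
    (g : comod_hom N Q) t :
  coact (smash P Q) (tmapl f g t) = gmap (tmapl f g) (coact (smash M N) t).
Proof.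
move: t; apply: tens_ext => [t u|t u|m n].
- by rewrite !linearD.
- by rewrite linearD gmapD.
by rewrite tmapl_pure !coact_smash !hom_coact gmul_map.
Qed.

Definition smash_map (M N P Q : comodule H) (f : comod_hom M P)
  (g : comod_hom N Q) : comod_hom (smash M N) (smash P Q) :=
  ComodHom (M := smash M N) (N := smash P Q) (smash_map_coact f g).

Definition swap_in M N P (m : P) : tens M N -> tens (tens M P) N :=
  tlift (fun f n => pure (pure f m) n).

Lemma swap_in_balanced M N P (m : P) :
  balanced (fun (f : M) (n : N) => pure (pure f m) n).
Proof.
split=> *.
- by rewrite !pureDl.
- by rewrite !pureDr.
- by rewrite -scale_pure pureZ.
Qed.

Lemma swap_in_linear M N P (m : P) : linear (@swap_in M N P m).
Proof.
apply: tliftl_linear; first exact: swap_in_balanced.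
by move=> *; rewrite -!scale_pure.
Qed.

Lemma swap_inD M N P (m : P) (t u : tens M N) :
  swap_in m (t + u) = swap_in m t + swap_in m u.
Proof. exact: (linearD (mklin (swap_in_linear m))). Qed.
Lemma swap_in0 M N P (m : P) : swap_in m (0 : tens M N) = 0.
Proof. exact: (linear0 (mklin (swap_in_linear m))). Qed.
Lemma swap_inZ M N P (m : P) a (t : tens M N) :
  swap_in m (a *: t) = a *: swap_in m t.
Proof. exact: (linearZ_LR (mklin (swap_in_linear m))). Qed.

Lemma swap_in_pure M N P (p : P) (m : M) (n : N) :
  swap_in p (pure m n) = pure (pure m p) n.
Proof. exact/tlift_pure/swap_in_balanced. Qed.

Lemma swap_balanced M N P : balanced (fun (t : tens M N) (m : P) => swap_in m t).
Proof.
split=> [t t' m|t m m'|a t m].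
- by rewrite swap_inD.
- elim/tens_ind: t => [|t t' e e'|f n].
  + by rewrite !swap_in0 addr0.
  + by rewrite !swap_inD e e' addrACA.
  + by rewrite !swap_in_pure pureDr pureDl.
- rewrite swap_inZ.
  elim/tens_ind: t => [|t t' e e'|f n].
  + by rewrite !swap_in0 scaler0.
  + by rewrite !swap_inD scalerDr e e'.
  + by rewrite !swap_in_pure !scale_pure pureZ.
Qed.

Lemma swap_linear M N P :
  linear (tlift (fun (t : tens M N) (m : P) => swap_in m t)).
Proof.
apply: tliftl_linear; first exact: swap_balanced.
by move=> a t m; rewrite swap_inZ.
Qed.

(* (m (x) n) (x) p |-> (m (x) p) (x) n *)
Definition swap M N P : {linear tens (tens M N) P -> tens (tens M P) N} :=
  mklin (@swap_linear M N P).

Lemma swap_pure M N P m n p :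
  swap M N P (pure (pure m n) p) = pure (pure m p) n.
Proof. by rewrite /= tlift_pure ?swap_in_pure //; apply: swap_balanced. Qed.

Lemma gmap_swap M N P (u : GT M) (v : GT N) (w : GT P) :
  gmap (swap M N P) (gmul (gmul u v) w) = gmul (gmul u w) v.
Proof.
elim/gt_ind: u => [|u u' e e'|x m].
- by rewrite !gmul0l gmap0.
- by rewrite !gmulDl gmapD e e'.
elim/gt_ind: v => [|v v' e e'|y n].
- by rewrite !(gmul0l, gmul0r) gmap0.
- by rewrite !(gmulDr, gmulDl) gmapD e e'.
elim/gt_ind: w => [|w w' e e'|z p].
- by rewrite !(gmul0l, gmul0r) gmap0.
- by rewrite !(gmulDr, gmulDl) gmapD e e'.
by rewrite !gmul_pure gmap_pure swap_pure mulrAC.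
Qed.

Lemma swap_coact (M N P : comodule H) t :
  coact (smash (smash M P) N) (swap M N P t) =
  gmap (swap M N P) (coact (smash (smash M N) P) t).
Proof.
move: t; apply: tens_ext => [t u|t u|t p].
- by rewrite !linearD.
- by rewrite linearD gmapD.
move: t; apply: tens_ext => [t u|t u|m n].
- by rewrite pureDl !linearD.
- by rewrite pureDl linearD gmapD.
by rewrite swap_pure !coact_smash gmap_swap.
Qed.

Definition smash_swap (M N P : comodule H) :
    comod_hom (smash (smash M N) P) (smash (smash M P) N) :=
  ComodHom (M := smash (smash M N) P) (N := smash (smash M P) N)
    (@swap_coact M N P).

Lemma unitl_balanced M : balanced (fun (a : A^o) (m : M) => a *: m).
Proof.
split=> *; rewrite ?scalerDl ?scalerDr //.
by rewrite scalerA mulrC.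
Qed.

Lemma unitl_linear M : linear (tlift (fun (a : A^o) (m : M) => a *: m)).
Proof.
apply: tliftl_linear; first exact: unitl_balanced.
by move=> *; rewrite scalerA.
Qed.

Definition unitl M : {linear tens A^o M -> M} := mklin (@unitl_linear M).

Lemma unitl_pure M a (m : M) : unitl M (pure a m) = a *: m.
Proof. exact/tlift_pure/unitl_balanced. Qed.

Lemma unitl_coact (M : comodule H) t :
  coact M (unitl M t) = gmap (unitl M) (coact (smash unit_comod M) t).
Proof.
move: t; apply: tens_ext => [t u|t u|a m].
- by rewrite !linearD.
- by rewrite linearD gmapD.
rewrite unitl_pure coact_smash linearZ_LR gt_scaleE.
have -> : coact unit_comod a = gpure (etaL H a) (1 : A^o) by [].
move: (coact M m) => v.
elim/gt_ind: v => [|v v' e e'|y n].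
- by rewrite gact0 gmul0r gmap0.
- by rewrite gactD gmulDr gmapD e e'.
- by rewrite gact_pure gmul_pure gmap_pure unitl_pure scale1r.
Qed.

Definition smash_unitl (M : comodule H) : comod_hom (smash unit_comod M) M :=
  ComodHom (M := smash unit_comod M) (@unitl_coact M).

(* An object F(M, N) with a bijection between the morphisms L -> F(M, N) and
   the morphisms L /\ M -> N, natural in L. *)
Record internal_hom (M N : comodule H) := InternalHom {
  ihom :> comodule H;
  ihom_adj : forall L, comod_hom L ihom -> comod_hom (smash L M) N;
  ihom_adj_inv : forall L, comod_hom (smash L M) N -> comod_hom L ihom;
  ihom_adjK : forall L, cancel (@ihom_adj L) (@ihom_adj_inv L);
  ihom_adj_invK : forall L, cancel (@ihom_adj_inv L) (@ihom_adj L);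
  ihom_adj_nat : forall L L' (h : comod_hom L' L) (f : comod_hom L ihom),
    ihom_adj (comod_comp f h) =
    comod_comp (ihom_adj f) (smash_map h (comod_id M))
}.

Definition ihom_ev (M N : comodule H) (F : internal_hom M N) :
  comod_hom (smash F M) N := ihom_adj (comod_id F).

(* The natural map F(M, A) /\ N -> F(M, N), adjoint to
   (F(M, A) /\ N) /\ M = (F(M, A) /\ M) /\ N -> A /\ N = N. *)
Definition dual_map (M N : comodule H) (D : internal_hom M unit_comod)
    (F : internal_hom M N) : comod_hom (smash D N) F :=
  ihom_adj_inv F
    (comod_comp (smash_unitl N)
      (comod_comp (smash_map (ihom_ev D) (comod_id N)) (smash_swap D N M))).

End Monoidal.

Section LinearMaps.
Variables (A : comPzRingType) (M N : lmodType A).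

Definition lhom : Type := {linear M -> N}.
HB.instance Definition _ := gen_eqMixin lhom.
HB.instance Definition _ := gen_choiceMixin lhom.

Definition lhom_fun (f : lhom) : {linear M -> N} := f.

Lemma lhom0_linear : linear (fun _ : M => 0 : N).
Proof. by move=> a u v; rewrite scaler0 addr0. Qed.
Lemma lhomN_linear (f : lhom) : linear (fun m : M => - lhom_fun f m).
Proof. by move=> a u v; rewrite linearP opprD scalerN. Qed.
Lemma lhomD_linear (f g : lhom) :
  linear (fun m : M => lhom_fun f m + lhom_fun g m).
Proof. by move=> a u v; rewrite !linearP scalerDr addrACA. Qed.
Lemma lhomZ_linear (c : A) (f : lhom) : linear (fun m : M => c *: lhom_fun f m).
Proof. by move=> a u v; rewrite linearP scalerDr !scalerA mulrC. Qed.

Definition lhom0 : lhom := mklin lhom0_linear.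
Definition lhomN f : lhom := mklin (lhomN_linear f).
Definition lhomD f g : lhom := mklin (lhomD_linear f g).
Definition lhomZ c f : lhom := mklin (lhomZ_linear c f).

Lemma lhomDA : associative lhomD.
Proof. by move=> f g h; apply: lin_ext => m; exact: addrA. Qed.
Lemma lhomDC : commutative lhomD.
Proof. by move=> f g; apply: lin_ext => m; exact: addrC. Qed.
Lemma lhomD0 : left_id lhom0 lhomD.
Proof. by move=> f; apply: lin_ext => m; exact: add0r. Qed.
Lemma lhomDN : left_inverse lhom0 lhomN lhomD.
Proof. by move=> f; apply: lin_ext => m; exact: addNr. Qed.

HB.instance Definition _ :=
  GRing.isZmodule.Build lhom lhomDA lhomDC lhomD0 lhomDN.

Lemma lhomZA a b f : lhomZ a (lhomZ b f) = lhomZ (a * b) f.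
Proof. by apply: lin_ext => m; exact: scalerA. Qed.
Lemma lhomZ1 : left_id 1 lhomZ.
Proof. by move=> f; apply: lin_ext => m; exact: scale1r. Qed.
Lemma lhomZDr : right_distributive lhomZ +%R.
Proof. by move=> a f g; apply: lin_ext => m; exact: scalerDr. Qed.
Lemma lhomZDl f : {morph lhomZ^~ f : a b / a + b}.
Proof. by move=> a b; apply: lin_ext => m; exact: scalerDl. Qed.

HB.instance Definition _ :=
  GRing.Zmodule_isLmodule.Build A lhom lhomZA lhomZ1 lhomZDr lhomZDl.

End LinearMaps.

Record submod (A : comPzRingType) (V : lmodType A) := Submod {
  smem : V -> Prop;
  smem0 : smem 0;
  smemP : forall a u v, smem u -> smem v -> smem (a *: u + v)
}.

Section Submodule.
Variables (A : comPzRingType) (V : lmodType A) (S : submod V).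

Definition subm : Type := {x : V | `[< smem S x >]}.
HB.instance Definition _ := Choice.on subm.

Definition sub_of (x : V) (h : smem S x) : subm := exist _ x (asboolT h).
Definition sub_val (x : subm) : V := sval x.

Lemma sub_memP (x : subm) : smem S (sub_val x).
Proof. exact/asboolP/(svalP x). Qed.
Lemma sub_val_inj : injective sub_val.
Proof. exact: val_inj. Qed.

Lemma smemD u v : smem S u -> smem S v -> smem S (u + v).
Proof. by move=> hu hv; rewrite -[u]scale1r; apply: smemP. Qed.
Lemma smemZ a u : smem S u -> smem S (a *: u).
Proof. by move=> hu; rewrite -[_ *: u]addr0; apply: smemP (smem0 S). Qed.
Lemma smemN u : smem S u -> smem S (- u).
Proof. by rewrite -scaleN1r; apply: smemZ. Qed.

Definition sub0 : subm := sub_of (smem0 S).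
Definition subD (x y : subm) : subm := sub_of (smemD (sub_memP x) (sub_memP y)).
Definition subN (x : subm) : subm := sub_of (smemN (sub_memP x)).
Definition subZ a (x : subm) : subm := sub_of (smemZ a (sub_memP x)).

Lemma subDA : associative subD.
Proof. by move=> x y z; apply: sub_val_inj; exact: addrA. Qed.
Lemma subDC : commutative subD.
Proof. by move=> x y; apply: sub_val_inj; exact: addrC. Qed.
Lemma subD0 : left_id sub0 subD.
Proof. by move=> x; apply: sub_val_inj; exact: add0r. Qed.
Lemma subDN : left_inverse sub0 subN subD.
Proof. by move=> x; apply: sub_val_inj; exact: addNr. Qed.

HB.instance Definition _ := GRing.isZmodule.Build subm subDA subDC subD0 subDN.

Lemma subZA a b x : subZ a (subZ b x) = subZ (a * b) x.
Proof. by apply: sub_val_inj; exact: scalerA. Qed.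
Lemma subZ1 : left_id 1 subZ.
Proof. by move=> x; apply: sub_val_inj; exact: scale1r. Qed.
Lemma subZDr : right_distributive subZ +%R.
Proof. by move=> a x y; apply: sub_val_inj; exact: scalerDr. Qed.
Lemma subZDl x : {morph subZ^~ x : a b / a + b}.
Proof. by move=> a b; apply: sub_val_inj; exact: scalerDl. Qed.

HB.instance Definition _ :=
  GRing.Zmodule_isLmodule.Build A subm subZA subZ1 subZDr subZDl.

Lemma sub_val_linear : linear sub_val.
Proof. by []. Qed.
Definition sub_incl : {linear subm -> V} := mklin sub_val_linear.

Lemma sub_incl_inj : injective sub_incl.
Proof. exact: sub_val_inj. Qed.

End Submodule.

Section KernelImage.
Variables (A : comPzRingType) (P Q : lmodType A) (f : {linear P -> Q}).

Lemma ker_mem0 : f 0 = 0. Proof. exact: linear0. Qed.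
Lemma ker_memP a u v : f u = 0 -> f v = 0 -> f (a *: u + v) = 0.
Proof. by move=> fu fv; rewrite linearP fu fv scaler0 addr0. Qed.
Definition kerm : submod P := Submod (smem := fun u => f u = 0) ker_mem0 ker_memP.

Lemma im_mem0 : exists p, 0 = f p.
Proof. by exists 0; rewrite linear0. Qed.
Lemma im_memP a u v :
  (exists p, u = f p) -> (exists p, v = f p) -> exists p, a *: u + v = f p.
Proof. by move=> [p ->] [q ->]; exists (a *: p + q); rewrite linearP. Qed.
Definition imm : submod Q :=
  Submod (smem := fun u => exists p, u = f p) im_mem0 im_memP.

Definition to_im (p : P) : subm imm := sub_of (S := imm) (ex_intro _ p erefl).
Lemma to_im_linear : linear to_im.
Proof. by move=> a u v; apply: sub_val_inj; exact: linearP. Qed.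
Definition to_iml : {linear P -> subm imm} := mklin to_im_linear.

Lemma im_section (q : subm imm) : {p | to_im p = q}.
Proof.
have /cid [p e] : exists p, sub_val q = f p by exact: (sub_memP q).
by exists p; apply: sub_val_inj.
Qed.

(* [tens_sub t u]: t - u comes from X (x) ker f. *)
Variable X : lmodType A.

Definition tens_sub (t u : tens X P) : Prop :=
  exists w : tens X (subm kerm),
    t = u + tmap idfun (sub_incl kerm) w.

Lemma tens_sub_refl t : tens_sub t t.
Proof.
by exists 0; rewrite tmap0 addr0.
Qed.
Lemma tens_sub_sym t u : tens_sub t u -> tens_sub u t.
Proof.
move=> [w ->]; exists (- w).
by rewrite tmapN addrK.
Qed.
Lemma tens_sub_trans t u v : tens_sub t u -> tens_sub u v -> tens_sub t v.
Proof.
move=> [w ->] [w' ->]; exists (w' + w).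
by rewrite tmapD addrA.
Qed.
Lemma tens_subD t t' u u' :
  tens_sub t t' -> tens_sub u u' -> tens_sub (t + u) (t' + u').
Proof.
move=> [w ->] [w' ->]; exists (w + w').
by rewrite tmapD addrACA.
Qed.
Lemma tens_sub_pure x p p' : f p = f p' -> tens_sub (pure x p) (pure x p').
Proof.
move=> e; have h : smem kerm (p - p') by rewrite /= linearB e subrr.
exists (pure x (sub_of h)); rewrite (tmap_pure idfun) -pureDr /=.
by rewrite addrC subrK.
Qed.

Let s (q : subm imm) : P := projT1 (im_section q).
Let sE q : f (s q) = sub_val q.
Proof. by rewrite -[in RHS](projT2 (im_section q)). Qed.

Let lift (l : seq (X * subm imm)) : tens X P :=
  tens_of [seq (p.1, s p.2) | p <- l].

Let lift_cat l l' : lift (l ++ l') = lift l + lift l'.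
Proof. by rewrite /lift map_cat tens_cat. Qed.
Let lift1 x q : lift [:: (x, q)] = pure x (s q). Proof. by []. Qed.
Let lift2 x q x' q' :
  lift [:: (x, q); (x', q')] = pure x (s q) + pure x' (s q').
Proof. exact: (lift_cat [:: _] [:: _]). Qed.

Lemma tens_eq_lift l l' : tens_eq l l' -> tens_sub (lift l) (lift l').
Proof.
elim=> {l l'}.
- by move=> l; apply: tens_sub_refl.
- by move=> *; apply: tens_sub_sym.
- by move=> l l' l'' _ h _; apply: tens_sub_trans.
- by move=> *; rewrite !lift_cat; apply: tens_subD.
- by move=> *; rewrite !lift_cat addrC; apply: tens_sub_refl.
- move=> q; rewrite lift1.
  have -> : pure 0 (s q) = 0 :> tens X P.
    by apply: (addrI (pure 0 (s q))); rewrite -pureDl !addr0.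
  exact: tens_sub_refl.
- by move=> *; rewrite lift1 lift2 pureDl; apply: tens_sub_refl.
- move=> x q q'; rewrite lift1 lift2 -pureDr; apply: tens_sub_pure.
  by rewrite linearD !sE.
- move=> a x q; rewrite !lift1 pureZ; apply: tens_sub_pure.
  by rewrite linearZ_LR !sE.
Qed.

Lemma tens_ker (t : tens X P) : tmap idfun to_iml t = 0 ->
  exists w : tens X (subm kerm), tmap idfun (sub_incl kerm) w = t.
Proof.
have key : exists l, tens_of l = tmap idfun to_iml t /\ tens_sub t (lift l).
  elim/tens_ind: t => [|t u [l [e h]] [l' [e' h']]|x p].
  - exists [::]; rewrite tmap0; split=> //.
    exact: tens_sub_refl.
  - exists (l ++ l'); rewrite tens_cat e e'.
    rewrite tmapD lift_cat; split=> //.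
    exact: tens_subD.
  - exists [:: (x, to_im p)]; rewrite (tmap_pure idfun to_iml); split=> //.
    by rewrite lift1; apply: tens_sub_pure; rewrite sE.
move=> t0; case: key => l [e h].
have {e t0} /tens_ofP/tens_eq_lift h' : tens_of l = tens_of [::].
  by rewrite e t0.
have [w ->] := tens_sub_trans h h'.
by exists w; rewrite {1}/lift /= tens_nil add0r.
Qed.

Lemma flat_tens_ker (t : tens X P) : flat_module X -> tmap idfun f t = 0 ->
  exists w : tens X (subm kerm), tmap idfun (sub_incl kerm) w = t.
Proof.
move=> flatX t0; apply: tens_ker.
apply: (flatX _ _ (sub_incl imm) (@sub_incl_inj _ _ _)).
rewrite -/(tmap idfun (sub_incl imm)).
rewrite tmap0 -t0.
elim/tens_ind: {t0} t => [|t u e e'|x p].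
- by rewrite !tmap0.
- by rewrite !tmapD e e'.
- by rewrite !tmap_pure.
Qed.

End KernelImage.

(* The extended comodule G (x) Hom_A(M, N) represents A-linear maps
   L (x) M -> N. Such a map is a comodule morphism when its two composites to
   G (x) N agree, so F(M, N) is the kernel of the difference [ihD] of the two
   induced maps into G (x) Hom_A(M, G (x) N); flatness of G makes that kernel a
   subcomodule. *)
Section Closed.
Variables (k : comPzRingType) (H : hopf_algebroid k) (flatH : flat H).
Variables M N : comodule H.
Local Notation A := (hA H).
Local Notation G := (hG H).
Local Notation GT := (gten H).
Local Notation gassoc := (gassoc (Delta H)).

Let V : lmodType A := lhom M N.
Let W : lmodType A := lhom M (GT N).

Lemma lhom_ev_balanced : balanced (fun (f : V) (m : M) => lhom_fun f m).
Proof.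
split=> [f g m|f m m'|a f m] //; first exact: linearD.
by rewrite linearZ_LR.
Qed.

Lemma lhom_ev_linear : linear (tlift (fun (f : V) (m : M) => lhom_fun f m)).
Proof. by apply: tliftl_linear; first exact: lhom_ev_balanced. Qed.

Definition lhom_ev : {linear tens V M -> N} := mklin lhom_ev_linear.

Lemma lhom_ev_pure f m : lhom_ev (pure f m) = lhom_fun f m.
Proof. exact/tlift_pure/lhom_ev_balanced. Qed.

Definition del0 (t : GT V) : W := coact N \o lhom_fun (gcounit t).

Lemma del0_linear : linear del0.
Proof.
move=> a t u; apply: lin_ext => m.
rewrite -[LHS]/(coact N (lhom_fun (gcounitl V (a *: t + u)) m)) linearP.
exact: linearP.
Qed.

Lemma del1_linear_in (t : GT V) :
  linear (fun m : M => gmap lhom_ev (gmul t (coact M m)) : GT N).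
Proof.
move=> a m n; rewrite linearP gmulDr gmapD; congr (_ + _).
by rewrite !gt_scaleE gmul_actr gmap_act.
Qed.

Definition del1 (t : GT V) : W := mklin (del1_linear_in t).

Lemma del1_linear : linear del1.
Proof.
move=> a t u; apply: lin_ext => m.
rewrite -[LHS]/(gmap lhom_ev (gmul (a *: t + u) (coact M m))).
by rewrite gmulDl gmapD gt_scaleE gmul_actl gmap_act.
Qed.

Lemma del_linear : linear (fun t => del0 t - del1 t).
Proof.
move=> a t u; rewrite del0_linear del1_linear scalerBr.
by rewrite opprD addrACA.
Qed.

Definition del : {linear GT V -> W} := mklin del_linear.

Definition ihD : {linear GT V -> GT W} := gmapl del \o gassocl V.

Lemma ihDE t : ihD t = gmap del (gassoc t : GT (GT V)). Proof. by []. Qed.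

Let K : lmodType A := subm (kerm ihD).
Let i : {linear K -> GT V} := sub_incl (kerm ihD).

Lemma incl_ker (t : K) : ihD (i t) = 0.
Proof. exact: (@sub_memP _ _ (kerm ihD) t). Qed.

Lemma incl_del (t : K) : del0 (i t) = del1 (i t).
Proof.
apply/eqP; rewrite -subr_eq0; apply/eqP.
rewrite -[LHS]/(del (i t)) -{1}[i t]gassoc_counit -gcounit_map.
by rewrite -ihDE incl_ker gcounit0.
Qed.

Lemma gmap_inj (P Q : lmodType A) (f : {linear P -> Q}) :
  injective f -> injective (gmap f : GT P -> GT Q).
Proof. exact: flatH. Qed.

Lemma ih_coact_ex (t : K) :
  exists w : GT K, gmap i w = gassoc (i t) :> GT (GT V).
Proof.
apply: (@flat_tens_ker A _ _ ihD _ (gassoc (i t) : GT (GT V)) flatH).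
rewrite -[LHS]/(gmap ihD (gassoc (i t) : GT (GT V)) : GT (GT W)).
rewrite -[LHS]/(gmap (gmapl del \o gassocl V) (gassoc (i t) : GT (GT V))
  : GT (GT W)).
rewrite -gmap_comp -gassoc_assoc -gassoc_map -ihDE incl_ker.
exact: gassoc0.
Qed.

Definition ih_coact_fun (t : K) : GT K := projT1 (cid (ih_coact_ex t)).

Lemma ih_coact_funE t : gmap i (ih_coact_fun t) = gassoc (i t) :> GT (GT V).
Proof. exact: (projT2 (cid (ih_coact_ex t))). Qed.

Lemma gmap_i_inj : injective (gmap i : GT K -> GT (GT V)).
Proof. exact/gmap_inj/sub_incl_inj. Qed.

Lemma ih_coact_linear : linear ih_coact_fun.
Proof.
move=> a t u; apply: gmap_i_inj.
rewrite ih_coact_funE gmapD gt_scaleE gmap_act !ih_coact_funE.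
by rewrite linearP; exact: (linearP (gassocl V)).
Qed.

Definition ih_coact : {linear K -> GT K} := mklin ih_coact_linear.

Lemma ih_coactE t : gmap i (ih_coact t) = gassoc (i t) :> GT (GT V).
Proof. exact: ih_coact_funE. Qed.

Lemma ih_counit t : gcounit (ih_coact t) = t.
Proof.
apply: (@sub_incl_inj _ _ (kerm ihD)).
by rewrite -/i -gcounit_map ih_coactE gassoc_counit.
Qed.

Lemma ih_coassoc t :
  gassoc (ih_coact t) = gmap ih_coact (ih_coact t) :> GT (GT K).
Proof.
apply: (@gmap_inj _ _ (gmapl i)); first exact: gmap_i_inj.
rewrite -gassoc_map ih_coactE gassoc_assoc gmap_comp.
transitivity (gmap (gassocl V \o i) (ih_coact t) : GT (GT (GT V))).
  by rewrite -gmap_comp ih_coactE.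
by apply: eq_gmap => u /=; rewrite -/ih_coact ih_coactE.
Qed.

Definition ih_obj : comodule H :=
  Comodule (csort := K) ih_counit ih_coassoc.

Definition ih_fun (t : ih_obj) : V := gcounit (i t).

Lemma ih_fun_linear : linear ih_fun.
Proof.
move=> a t u; rewrite /ih_fun.
by rewrite linearP; exact: (linearP (gcounitl V)).
Qed.
Definition ih_funl : {linear ih_obj -> V} := mklin ih_fun_linear.

Definition ih_ev : {linear tens ih_obj M -> N} :=
  lhom_ev \o tmapl ih_funl idfun.

Lemma ih_ev_pure t m : ih_ev (pure t m) = lhom_fun (ih_fun t) m.
Proof.
rewrite -[LHS]/(lhom_ev (tmapl ih_funl idfun (pure t m))).
by rewrite tmapl_pure lhom_ev_pure.
Qed.

Lemma ih_fun_coact (t : ih_obj) : gmap ih_funl (ih_coact t) = i t :> GT V.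
Proof.
transitivity (gmap (gcounitl V \o i) (ih_coact t) : GT V).
  exact: eq_gmap.
by rewrite -gmap_comp ih_coactE gassoc_mapcounit.
Qed.

Lemma ih_ev_coact t :
  coact N (ih_ev t) = gmap ih_ev (coact (smash ih_obj M) t).
Proof.
move: t; apply: tens_ext => [t u|t u|t m].
- by rewrite !linearD.
- by rewrite linearD gmapD.
rewrite ih_ev_pure coact_smash.
rewrite -[LHS]/(lhom_fun (del0 (i t)) m) incl_del.
rewrite -[LHS]/(gmap lhom_ev (gmul (i t) (coact M m)) : GT N).
rewrite -[RHS]/(gmap (lhom_ev \o tmapl ih_funl idfun)
  (gmul (ih_coact t) (coact M m)) : GT N).
rewrite -gmap_comp -gmul_map ih_fun_coact.
by rewrite gmap_id.
Qed.

Definition ih_evh : comod_hom (smash ih_obj M) N :=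
  ComodHom (M := smash ih_obj M) ih_ev_coact.

Definition ih_adj (L : comodule H) (f : comod_hom L ih_obj) :
    comod_hom (smash L M) N :=
  comod_comp ih_evh (smash_map f (comod_id M)).

Lemma ih_adj_pure (L : comodule H) (f : comod_hom L ih_obj) l m :
  ih_adj f (pure l m) = lhom_fun (ih_fun (f l)) m.
Proof.
rewrite -[LHS]/(ih_ev (tmapl f idfun (pure l m))).
by rewrite tmapl_pure ih_ev_pure.
Qed.

Lemma ih_adj_inj (L : comodule H) : injective (@ih_adj L).
Proof.
move=> f g e; apply: comod_hom_ext => l; apply: (@sub_incl_inj _ _ (kerm ihD)).
have key (u : comod_hom L ih_obj) : i (u l) =
    gmap (ih_funl \o u) (coact L l) :> GT V.
  rewrite -ih_fun_coact -gmap_comp.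
  by rewrite -[ih_coact (u l)]/(coact ih_obj (u l)) hom_coact.
rewrite -[LHS]/(i (f l)) -[RHS]/(i (g l)) !key.
apply: eq_gmap => x; apply: lin_ext => m.
have := congr1 (fun u : comod_hom (smash L M) N => u (pure x m)) e.
by rewrite !ih_adj_pure.
Qed.

Section Curry.
Variables (L : comodule H) (h : comod_hom (smash L M) N).

Lemma curry_linear_in l : linear (fun m : M => h (pure l m)).
Proof. by move=> a m n; rewrite pureDr -pureZ -scale_pure linearP. Qed.

Definition curry (l : L) : V := mklin (curry_linear_in l).

Lemma curry_linear : linear curry.
Proof.
move=> a l l'; apply: lin_ext => m.
rewrite -[LHS]/(h (pure (a *: l + l') m)).
by rewrite pureDl -scale_pure linearP.
Qed.

Definition curryl : {linear L -> V} := mklin curry_linear.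

Definition lift_fun : {linear L -> GT V} := gmapl curryl \o coact L.

Lemma lift_funE l : lift_fun l = gmap curryl (coact L l) :> GT V.
Proof. by []. Qed.

Lemma lift_counit l : gcounit (lift_fun l) = curry l.
Proof. by rewrite lift_funE gcounit_map coact_counit. Qed.

Lemma lift_del l : del (lift_fun l) = 0.
Proof.
apply/eqP; rewrite subr_eq0; apply/eqP; apply: lin_ext => m.
rewrite -[LHS]/(coact N (lhom_fun (gcounit (lift_fun l)) m)) lift_counit.
rewrite -[LHS]/(coact N (h (pure l m))) hom_coact coact_smash.
rewrite -[RHS]/(gmap lhom_ev (gmul (gmap curryl (coact L l)) (coact M m))).
rewrite -{2}[coact M m]gmap_id (gmul_map curryl idfun) gmap_comp.
apply: eq_gmap.
apply: (@lin_tens_ext _ _ _ _ h (lhom_ev \o tmapl curryl idfun)) => x y.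
rewrite -[RHS]/(lhom_ev (tmapl curryl idfun (pure x y))).
by rewrite tmapl_pure lhom_ev_pure.
Qed.

Lemma lift_assoc l :
  gassoc (lift_fun l) = gmap lift_fun (coact L l) :> GT (GT V).
Proof. by rewrite lift_funE gassoc_map coact_coassoc gmap_comp. Qed.

Lemma lift_ker l : smem (kerm ihD) (lift_fun l).
Proof.
rewrite -[smem _ _]/(ihD (lift_fun l) = 0) ihDE lift_assoc gmap_comp.
rewrite (eq_gmap (g := fun _ => 0)); last exact: lift_del.
elim/gt_ind: (coact L l) => [|t t' e e'|x y].
- exact: (gmap0 (lhom0 L W)).
- by rewrite (gmapD (lhom0 L W)) e e' addr0.
- rewrite (gmap_pure (lhom0 L W)) /=.
  by apply: (addrI (gpure x (0 : W) : GT W)); rewrite -gpureDr !addr0.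
Qed.

Definition uncurry_fun (l : L) : ih_obj := sub_of (lift_ker l).

Lemma uncurry_linear : linear uncurry_fun.
Proof.
move=> a l l'; apply: (@sub_incl_inj _ _ (kerm ihD)).
exact: (linearP lift_fun).
Qed.
Definition uncurry_lin : {linear L -> ih_obj} := mklin uncurry_linear.

Lemma uncurry_coact l :
  coact ih_obj (uncurry_lin l) = gmap uncurry_lin (coact L l).
Proof.
apply: gmap_i_inj; rewrite ih_coactE gmap_comp.
rewrite -[i _]/(lift_fun l) lift_assoc.
exact: eq_gmap.
Qed.

Definition ih_adj_inv : comod_hom L ih_obj := ComodHom uncurry_coact.

Lemma ih_adj_invK : ih_adj ih_adj_inv = h.
Proof.
apply: comod_hom_ext; apply: lin_tens_ext => l m; rewrite ih_adj_pure.
by rewrite /ih_fun -[i _]/(lift_fun l) lift_counit.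
Qed.

End Curry.

Lemma ih_adjK L : cancel (@ih_adj L) (@ih_adj_inv L).
Proof. by move=> f; apply: ih_adj_inj; rewrite ih_adj_invK. Qed.

Lemma ih_adj_nat (L L' : comodule H) (h : comod_hom L' L)
    (f : comod_hom L ih_obj) :
  ih_adj (comod_comp f h) =
  comod_comp (ih_adj f) (smash_map h (comod_id M)).
Proof.
apply: comod_hom_ext; apply: lin_tens_ext => l m; rewrite ih_adj_pure.
rewrite -[RHS]/(ih_adj f (tmapl h idfun (pure l m))).
by rewrite tmapl_pure ih_adj_pure.
Qed.

Definition ihom_flat : internal_hom M N :=
  InternalHom (ihom := ih_obj) ih_adjK ih_adj_invK ih_adj_nat.

End Closed.

Section Dualizable.
Variables (k : comPzRingType) (H : hopf_algebroid k).

Definition dualizable (flatH : flat H) (M : comodule H) : Prop :=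
  forall N : comodule H,
    comod_iso (dual_map (ihom_flat flatH M (unit_comod H)) (ihom_flat flatH M N)).

End Dualizable.

Definition finitely_generated (A : comPzRingType) (M : lmodType A) : Prop :=
  exists (n : nat) (e : 'I_n -> M),
    forall m : M, exists c : 'I_n -> A, m = \sum_(i < n) c i *: e i.

Definition projective (A : comPzRingType) (M : lmodType A) : Prop :=
  forall (P Q : lmodType A) (g : {linear P -> Q}) (f : {linear M -> Q}),
    (forall q, exists p, g p = q) ->
    exists h : {linear M -> P}, forall m, g (h m) = f m.

(* Main.v *)
Require Import Defs.
From mathcomp Require Import all_boot all_algebra.
From mathcomp Require Import boolp.

Set Implicit Arguments.
Unset Strict Implicit.
Unset Printing Implicit Defensive.

Import GRing.Theory.
Local Open Scope ring_scope.

(** Being finitely generated and projective means having a finite dual basis: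
    elements e_i of M and forms phi_i with m = sum_i phi_i(m) e_i.

    If M is dualizable, the isomorphism F(M, A) /\ M -> F(M, M) carries some
    t = sum_i d_i (x) e_i to the element of F(M, M) that represents the
    identity of M. Unfolding the adjunction, m = sum_i phi_i(m) e_i, where
    phi_i is the form underlying d_i, so M has a dual basis
    ([dualizable_dual_basis]).

    Conversely let M have a dual basis. The point is that F(M, N), defined as a
    submodule of G (x) Hom(M, N), is then isomorphic to Hom(M, N) as an
    A-module, through the map [ih_fun] that applies the counit. Write psi for
    the coactions and, for u in G (x) Hom(M, N) and v in G (x) M, write [u, v]
    for the product of the G-factors tensored with the evaluation of the
    Hom-factor ([lact]). The map

      G (x) Hom(M, N) -> Hom(M, G (x) N),   u |-> (m |-> [u, psi m])

    is bijective for every A-module N. Indeed, the pairing identifies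
    G (x) Hom(M, N) with the G-linear maps from G (x) M to G (x) N because of
    the dual basis, and thanks to the antipode psi extends to a G-linear
    isomorphism G (x) M -> G (x) M, where the source is formed with etaL
    instead of etaR. Injectivity and surjectivity are [lact_coact_inj] and
    [lact_coact_surj].

    An element u of F(M, N) satisfies [u, psi m] = psi (f m), where f is its
    counit. So f = 0 forces u = 0, and [ih_fun] is injective. For f in
    Hom(M, N), let u be the element with [u, psi m] = psi (f m) for all m. Its
    counit is f, and it lies in F(M, N): by injectivity for G (x) N, this
    follows from the coassociativity of M and N ([ih_fun_surj]). Under these
    isomorphisms F(M, A) (x) N -> F(M, N) becomes the evaluation map
    Hom(M, A) (x) N -> Hom(M, N), whose inverse sends f to
    sum_i phi_i (x) f(e_i). *)

(** * Dual bases *)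

Definition dual_basis (A : comPzRingType) (M : lmodType A) (n : nat)
    (e : 'I_n -> M) (phi : 'I_n -> lhom M A^o) : Prop :=
  forall m, \sum_(i < n) lhom_fun (phi i) m *: e i = m.

Lemma dual_basis_fg (A : comPzRingType) (M : lmodType A) n (e : 'I_n -> M) phi :
  dual_basis e phi -> finitely_generated M.
Proof.
move=> eP; exists n, e => m; exists (fun i => lhom_fun (phi i) m).
by rewrite eP.
Qed.

Lemma dual_basis_projective (A : comPzRingType) (M : lmodType A) n
    (e : 'I_n -> M) phi :
  dual_basis e phi -> projective M.
Proof.
move=> eP P Q g f gsurj.
have [p pE] := choice (fun i => gsurj (f (e i))).
pose h m := \sum_(i < n) (lhom_fun (phi i) m : A) *: p i.
have hlin : linear h.
  move=> a u v; rewrite /h scaler_sumr -big_split; apply: eq_bigr => i _ /=.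
  by rewrite linearP scalerDl scalerA.
exists (mklin hlin) => m; rewrite -[LHS]/(g (h m)) /h linear_sum.
rewrite -[in RHS](eP m) linear_sum; apply: eq_bigr => i _.
by rewrite !linearZ_LR pE.
Qed.

(** A splitting of the surjection from the free module on the generators
    has the dual basis as its coordinates. *)
Lemma fg_projective_dual_basis (A : comPzRingType) (M : lmodType A) :
  finitely_generated M -> projective M ->
  exists n (e : 'I_n -> M) phi, dual_basis e phi.
Proof.
move=> [n [e eP]] proj.
pose g (c : 'rV[A]_n) := \sum_(i < n) c 0 i *: e i.
have glin : linear g.
  move=> a u v; rewrite /g scaler_sumr -big_split; apply: eq_bigr => i _ /=.
  by rewrite !mxE scalerDl scalerA.
have [|h hP] := proj _ _ (mklin glin) idfun.
  move=> m; have [c ->] := eP m; exists (\row_i c i).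
  by apply: eq_bigr => i _; rewrite mxE.
have phi_lin i : linear (fun m => h m 0 i : A^o).
  by move=> a u v; rewrite linearP !mxE.
by exists n, e, (fun i => mklin (phi_lin i)) => m; exact: hP.
Qed.

(** Naming the module, rather than its carrier [lhom M N], lets unification
    find the linear structure under [gten] and [gmap]. *)
Definition lhomod (A : comPzRingType) (M N : lmodType A) : lmodType A := lhom M N.

Section Comodules.
Variables (k : comPzRingType) (H : hopf_algebroid k).
Local Notation A := (hA H).
Local Notation G := (hG H).
Local Notation GT := (gten H).
Local Notation gassoc := (gassoc (Delta H)).

(** * The antipode *)

Section Antipode.
Variables (P N : lmodType A) (w : {linear P -> GT N}).

Lemma chi_ext_balanced :
  @gbalanced A G (etaR H) P (GT N) (fun x p => gact (chi H x) (w p)).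
Proof.
apply: gbal => [x x' p|x p p'|a x p].
- by rewrite rmorphD gactDl.
- by rewrite linearD gactD.
- by rewrite linearZ_LR gt_scaleE gactA rmorphM chiR mulrC.
Qed.

(** Extending w along chi exchanges the two unit maps: [chi_ext w] is
    well defined on the tensor product over etaR because w is A-linear for
    etaL, and it is A-linear for the action of A on G (x) N through etaR. *)
Definition chi_ext : GT P -> GT N := glift (fun x p => gact (chi H x) (w p)).

Lemma chi_ext_pure x p : chi_ext (gpure x p) = gact (chi H x) (w p).
Proof. exact/glift_pure/chi_ext_balanced. Qed.
Lemma chi_extD t u : chi_ext (t + u) = chi_ext t + chi_ext u.
Proof. exact/gliftD/chi_ext_balanced. Qed.
Lemma chi_ext0 : chi_ext 0 = 0.
Proof. by apply: (addrI (chi_ext 0)); rewrite -chi_extD !addr0. Qed.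

Lemma chi_ext_act x t : chi_ext (gact x t) = gact (chi H x) (chi_ext t).
Proof.
elim/gt_ind: t => [|t t' e e'|y p].
- by rewrite !(gact0, chi_ext0).
- by rewrite !(gactD, chi_extD) e e'.
- by rewrite gact_pure !chi_ext_pure gactA rmorphM.
Qed.

Lemma chi_extZ a t : chi_ext (a *: t) = gact (etaR H a) (chi_ext t).
Proof. by rewrite gt_scaleE chi_ext_act chiL. Qed.

Lemma chi_ext2_balanced : @gbalanced A G (etaR H) (GT P) (GT N)
  (fun x t => gact x (chi_ext t)).
Proof.
apply: gbal => [x x' t|x t t'|a x t].
- by rewrite gactDl.
- by rewrite chi_extD gactD.
- by rewrite chi_extZ gactA mulrC.
Qed.

Definition chi_ext2 : GT (GT P) -> GT N := glift (fun x t => gact x (chi_ext t)).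

Lemma chi_ext2_pure x t : chi_ext2 (gpure x t) = gact x (chi_ext t).
Proof. exact/glift_pure/chi_ext2_balanced. Qed.
Lemma chi_ext2D t u : chi_ext2 (t + u) = chi_ext2 t + chi_ext2 u.
Proof. exact/gliftD/chi_ext2_balanced. Qed.
Lemma chi_ext20 : chi_ext2 0 = 0.
Proof. by apply: (addrI (chi_ext2 0)); rewrite -chi_ext2D !addr0. Qed.

(** On x (x) p the left side is sum x' chi(x'') w(p), so this is the law
    sum x' chi(x'') = etaL (eps x) of a groupoid: f composed with its inverse
    is an identity. *)
Lemma chi_ext2_assoc t : chi_ext2 (gassoc t) = w (gcounit t).
Proof.
elim/gt_ind: t => [|t t' e e'|x p].
- by rewrite gassoc0 gcounit0 chi_ext20 linear0.
- by rewrite gassocD gcounitD chi_ext2D linearD e e'.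
rewrite gassoc_pure gcounit_pure linearZ_LR gt_scaleE -Delta_invR.
rewrite /rlift (@tlift_add _ _ _ _ _ _ (fun y => gact y (w p))); last first.
  by move=> *; rewrite gactDl.
move: (Delta H x : GT (pull (etaL H) G^o)) => t.
have bal : @gbalanced A G (etaR H) (pull (etaL H) G^o) (GT N)
    (fun y z => gact (y * chi H z) (w p)).
  apply: gbal => [y y' z|y z z'|a y z].
  - by rewrite mulrDl gactDl.
  - by rewrite rmorphD mulrDr gactDl.
  - rewrite -[a *: z]/(etaL H a * z) rmorphM chiL.
    by rewrite -mulrA mulrCA.
elim/gt_ind: t => [|t t' e e'|y z].
- by rewrite dins0 chi_ext20 tlift0.
- by rewrite dinsD chi_ext2D [RHS]tliftD // e e'.
- by rewrite dins_pure chi_ext2_pure chi_ext_pure gactA [RHS]tlift_pure.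
Qed.

End Antipode.

(** On x (x) p this is the other inverse law, sum chi(x') x'' = etaR (eps x). *)
Lemma chi_ext_assoc (P : lmodType A) (t : GT P) :
  chi_ext idfun (gassoc t) = gpure 1 (gcounit t).
Proof.
elim/gt_ind: t => [|t t' e e'|x p].
- rewrite gassoc0 gcounit0 chi_ext0.
  by apply: (addrI (gpure 1 0)); rewrite -gpureDr !addr0.
- by rewrite gassocD gcounitD chi_extD e e' gpureDr.
rewrite gassoc_pure gcounit_pure -gpureZ mulr1 -Delta_invL.
rewrite /rlift (@tlift_add _ _ _ _ _ _ (fun y => gpure y p : GT P)); last first.
  by move=> *; rewrite gpureDl.
move: (Delta H x : GT (pull (etaL H) G^o)) => t.
have bal : @gbalanced A G (etaR H) (pull (etaL H) G^o) (GT P)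
    (fun y z => gpure (chi H y * z) p).
  apply: gbal => [y y' z|y z z'|a y z].
  - by rewrite rmorphD mulrDl gpureDl.
  - by rewrite mulrDr gpureDl.
  - rewrite -[a *: z]/(etaL H a * z) rmorphM chiR.
    by rewrite -mulrA mulrCA.
elim/gt_ind: t => [|t t' e e'|y z].
- by rewrite dins0 chi_ext0 tlift0.
- by rewrite dinsD chi_extD [RHS]tliftD // e e'.
- by rewrite dins_pure chi_ext_pure gact_pure [RHS]tlift_pure.
Qed.

(** The elements of G (x) M are G-linear combinations of coactions: with psi m =
    sum x (x) m', this is 1 (x) m = sum chi(x) psi(m'). *)
Lemma chi_ext_coact (M : comodule H) m :
  chi_ext (coact M) (coact M m) = gpure 1 m.
Proof.
rewrite -[in RHS](coact_counit m) -chi_ext_assoc coact_coassoc.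
elim/gt_ind: (coact M m) => [|t t' e e'|x p].
- by rewrite gmap0 !chi_ext0.
- by rewrite gmapD !chi_extD e e'.
- by rewrite gmap_pure !chi_ext_pure.
Qed.

(** * Twisted evaluation *)

Section Evaluation.
Variables (M : comodule H) (N : lmodType A).
Local Notation V := (lhomod M N).

Lemma lev_balanced : balanced (fun (f : V) (m : M) => lhom_fun f m).
Proof.
split=> [f g m|f m m'|a f m] //; first exact: linearD.
by rewrite linearZ_LR.
Qed.

Lemma lev_linear : linear (tlift (fun (f : V) (m : M) => lhom_fun f m)).
Proof. by apply: tliftl_linear; first exact: lev_balanced. Qed.

(** Unlike [lhom_ev], the target is just a module, so that G (x) N is allowed
    without its coaction. *)
Definition lev : {linear tens V M -> N} := mklin lev_linear.

Lemma lev_pure f m : lev (pure f m) = lhom_fun f m.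
Proof. exact/tlift_pure/lev_balanced. Qed.

(** (x (x) f, y (x) m) |-> x y (x) f(m). *)
Definition lact (u : GT V) (v : GT M) : GT N := gmap lev (gmul u v).

Lemma lact_pure x f y m :
  lact (gpure x f) (gpure y m) = gpure (x * y) (lhom_fun f m).
Proof. by rewrite /lact gmul_pure gmap_pure lev_pure. Qed.
Lemma lactDl u u' v : lact (u + u') v = lact u v + lact u' v.
Proof. by rewrite /lact gmulDl gmapD. Qed.
Lemma lactDr u v v' : lact u (v + v') = lact u v + lact u v'.
Proof. by rewrite /lact gmulDr gmapD. Qed.
Lemma lact0l v : lact 0 v = 0.
Proof. by rewrite /lact gmul0l gmap0. Qed.
Lemma lactNl u v : lact (- u) v = - lact u v.
Proof. by apply: (addrI (lact u v)); rewrite -lactDl !subrr lact0l. Qed.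
Lemma lact0r u : lact u 0 = 0.
Proof. by rewrite /lact gmul0r gmap0. Qed.
Lemma lact_actr u x v : lact u (gact x v) = gact x (lact u v).
Proof. by rewrite /lact gmul_actr gmap_act. Qed.

Lemma gcounit_lact u v : gcounit (lact u v) = lhom_fun (gcounit u) (gcounit v).
Proof. by rewrite /lact gcounit_map gcounit_mul lev_pure. Qed.

Lemma lact_coact_linear (u : GT V) : linear (fun m => lact u (coact M m)).
Proof. by move=> a m n; rewrite linearP lactDr !gt_scaleE lact_actr. Qed.

(** This is the map [del1] in the construction of the internal hom, for a target
    that is only a module. *)
Definition lact_coact (u : GT V) : lhom M (GT N) := mklin (lact_coact_linear u).

Lemma lact_coact_is_linear : linear lact_coact.
Proof.
move=> a u v; apply: lin_ext => m.
rewrite -[LHS]/(lact _ _) lactDl; congr (_ + _).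
by rewrite /lact gt_scaleE gmul_actl gmap_act.
Qed.

Definition lact_coactl : {linear GT V -> lhomod M (GT N)} :=
  mklin lact_coact_is_linear.

Section DualBasis.
Variables (n : nat) (e : 'I_n -> M) (phi : 'I_n -> lhom M A^o).
Hypothesis eP : dual_basis e phi.

Lemma rank1_linear_in (f : lhom M A^o) (x : N) :
  linear (fun m => (lhom_fun f m : A) *: x).
Proof. by move=> a u v; rewrite linearP scalerDl scalerA. Qed.

(** The image of f (x) x under Hom(M, A) (x) N -> Hom(M, N). *)
Definition rank1 (f : lhom M A^o) (x : N) : V := mklin (rank1_linear_in f x).

Lemma rank1_linear f : linear (rank1 f).
Proof.
move=> a x y; apply: lin_ext => m.
rewrite -[LHS]/((lhom_fun f m : A) *: (a *: x + y)) scalerDr.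
by rewrite scalerA mulrC -scalerA.
Qed.

Definition rank1l f : {linear N -> V} := mklin (rank1_linear f).

(** u is determined by the G-linear map [lact u], already by its values on the
    1 (x) e_i; this is where finite generation and projectivity are used. *)
Lemma lact_dual_basis (u : GT V) :
  \sum_(i < n) gmap (rank1l (phi i)) (lact u (gpure 1 (e i))) = u :> GT V.
Proof.
elim/gt_ind: u => [|u u' h h'|x f].
- by rewrite big1 // => i _; rewrite lact0l gmap0.
- rewrite -[in RHS]h -[in RHS]h' -big_split; apply: eq_bigr => i _ /=.
  by rewrite lactDl (gmapD (rank1l _)).
pose p (f : V) : GT V := gpure x f.
have pD f1 f2 : p (f1 + f2) = p f1 + p f2 by apply: gpureDr.
have p0 : p 0 = 0 by apply: (addrI (p 0)); rewrite -pD !addr0.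
transitivity (\sum_(i < n) p (rank1l (phi i) (lhom_fun f (e i)))).
  by apply: eq_bigr => i _; rewrite lact_pure gmap_pure mulr1.
rewrite -(big_morph p pD p0) /p; congr gpure; apply: lin_ext => m.
transitivity (\sum_(i < n) (lhom_fun (phi i) m : A) *: lhom_fun f (e i)).
  have hD (f1 f2 : V) : lhom_fun (f1 + f2) m = lhom_fun f1 m + lhom_fun f2 m by [].
  exact: (big_morph (fun f : V => lhom_fun f m) hD erefl).
rewrite -[in RHS](eP m) [RHS]linear_sum; apply: eq_bigr => i _.
by rewrite linearZ_LR.
Qed.

(** As the coactions span G (x) M over G, a u that kills them kills every
    1 (x) e_i. *)
Lemma lact_coact_inj (u : GT V) : (forall m, lact u (coact M m) = 0) -> u = 0.
Proof.
move=> u0; rewrite -(lact_dual_basis u) big1 // => i _.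
rewrite -chi_ext_coact.
suff -> t : lact u (chi_ext (coact M) t) = 0 by rewrite gmap0.
elim/gt_ind: t => [|t t' h h'|x m].
- by rewrite chi_ext0 lact0r.
- by rewrite chi_extD lactDr h h' addr0.
- by rewrite chi_ext_pure lact_actr u0 gact0.
Qed.

Lemma lact_rank1 f (t : GT N) x m :
  lact (gmap (rank1l f) t) (gpure x m) =
  gact x (gact (etaR H (lhom_fun f m)) t).
Proof.
elim/gt_ind: t => [|t t' h h'|y p].
- by rewrite gmap0 lact0l !gact0.
- by rewrite gmapD lactDl !gactD h h'.
- rewrite gmap_pure lact_pure !gact_pure -[lhom_fun _ m]/(_ *: p) -gpureZ.
  by congr gpure; rewrite [y * x]mulrC mulrCA.
Qed.

(** The map w prescribes a G-linear map on the coactions, whose value on 1 (x) m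
    must be [chi_ext w (coact M m)] by [chi_ext_coact]; the dual basis then
    gives u. *)
Lemma lact_coact_surj (w : {linear M -> GT N}) :
  exists u : GT V, forall m, lact u (coact M m) = w m.
Proof.
exists (\sum_(i < n) gmap (rank1l (phi i)) (chi_ext w (coact M (e i)))) => m.
rewrite -[in RHS](coact_counit m) -chi_ext2_assoc coact_coassoc.
have suml v (F : 'I_n -> GT V) :
    lact (\sum_(i < n) F i) v = \sum_(i < n) lact (F i) v.
  exact: (big_morph (lact^~ v) (fun u u' => lactDl u u' v) (lact0l v)).
elim/gt_ind: (coact M m) => [|v v' h h'|x p].
- by rewrite lact0r gmap0 chi_ext20.
- by rewrite lactDr gmapD chi_ext2D h h'.
rewrite gmap_pure chi_ext2_pure suml.
have gs (F : 'I_n -> GT N) : gact x (\sum_(i < n) F i) = \sum_(i < n) gact x (F i).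
  exact: (big_morph (gact x) (gactD x) (gact0 _ _ _ x)).
have cs (F : 'I_n -> GT M) :
    chi_ext w (\sum_(i < n) F i) = \sum_(i < n) chi_ext w (F i).
  exact: (big_morph (chi_ext w) (chi_extD w) (chi_ext0 w)).
rewrite -[in RHS](eP p) linear_sum cs gs; apply: eq_bigr => i _.
by rewrite linearZ_LR chi_extZ lact_rank1.
Qed.

End DualBasis.
End Evaluation.

(** * The internal hom *)

Lemma lact_postcomp (M : comodule H) (N P : lmodType A) (g : {linear N -> P})
    (h : {linear lhomod M N -> lhomod M P}) u v :
  (forall f m, lhom_fun (h f) m = g (lhom_fun f m)) ->
  lact (gmap h u) v = gmap g (lact u v).
Proof.
move=> hE; elim/gt_ind: u => [|u u' e e'|x f].
- by rewrite gmap0 !lact0l gmap0.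
- by rewrite gmapD !lactDl gmapD e e'.
elim/gt_ind: v => [|v v' e e'|y m].
- by rewrite !lact0r gmap0.
- by rewrite !lactDr gmapD e e'.
- by rewrite gmap_pure !lact_pure gmap_pure hE.
Qed.

(** Multiplicativity of the comultiplication and coassociativity of M. *)
Lemma lact_coact_assoc (M : comodule H) (N : lmodType A)
    (u : GT (lhomod M N)) m :
  lact (gmap (@lact_coactl M N) (gassoc u : GT (GT (lhomod M N)))) (coact M m) =
  gassoc (lact u (coact M m)) :> GT (GT N).
Proof.
rewrite [in RHS]/lact gassoc_map gassoc_mul coact_coassoc.
move: (gassoc u : GT (GT (lhomod M N))) (coact M m) => {}u v.
rewrite gmap_comp.
elim/gt_ind: u => [|u u' e e'|x u].
- by rewrite gmap0 lact0l gmul0l gmap0.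
- by rewrite gmapD lactDl gmulDl gmapD e e'.
elim/gt_ind: v => [|v v' e e'|y p].
- by rewrite lact0r gmap0 gmul0r gmap0.
- by rewrite lactDr gmapD gmulDr gmapD e e'.
rewrite !gmap_pure lact_pure gmul_pure gmap_pure; congr gpure.
by rewrite -[RHS]/(gmap (lev M N) (smash_g _ _ (pure u (coact M p)))) smash_g_pure.
Qed.

Lemma postcomp_linear (M N P : lmodType A) (g : {linear N -> P}) :
  linear (fun f : lhomod M N => g \o lhom_fun f : lhomod M P).
Proof. by move=> a f h; apply: lin_ext => m; exact: linearP. Qed.

Definition postl (M N P : lmodType A) (g : {linear N -> P}) :
  {linear lhomod M N -> lhomod M P} := mklin (postcomp_linear g).

Lemma gmap_sub (N P : lmodType A) (f g h : {linear N -> P}) (t : GT N) :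
  (forall x, h x = f x - g x) -> gmap h t = gmap f t - gmap g t :> GT P.
Proof.
move=> hE; elim/gt_ind: t => [|t t' e e'|x p].
- by rewrite !gmap0 subr0.
- by rewrite !gmapD e e' opprD addrACA.
apply: (addIr (gmap g (gpure x p : GT N))); rewrite subrK.
by rewrite !gmap_pure -gpureDr hE subrK.
Qed.

Section InternalHom.
Variables (flatH : flat H) (M N : comodule H).
Variables (n : nat) (e : 'I_n -> M) (phi : 'I_n -> lhom M A^o).
Hypothesis eP : dual_basis e phi.

Lemma ih_fun_inj : injective (@ih_fun k H flatH M N).
Proof.
move=> s t est; apply/eqP; rewrite -subr_eq0; apply/eqP.
have {est} : ih_fun (s - t) = 0.
  rewrite -[LHS]/(ih_funl flatH M N (s - t)) linearB.
  by rewrite [ih_funl _ _ _ s]est subrr.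
move: (s - t) => {s} {}t t0.
apply: (@sub_incl_inj _ _ (kerm (ihD M N))); rewrite linear0.
apply: (lact_coact_inj eP) => m.
rewrite -[LHS]/(lhom_fun (del1 (sub_incl _ t)) m) -incl_del.
rewrite -[LHS]/(coact N (lhom_fun (ih_fun t) m)) t0.
exact: linear0.
Qed.

(** The element u is forced: members of the internal hom satisfy [incl_del].
    Its membership is tested by pairing with the coactions of M, where the two
    terms of [del] become the two sides of the coassociativity of N at f(m). *)
Lemma ih_fun_surj (f : lhom M N) : exists t : ih_obj flatH M N, ih_fun t = f.
Proof.
have [u uE] := lact_coact_surj eP (coact N \o lhom_fun f).
have cu : gcounit u = f.
  apply: lin_ext => m; rewrite -[LHS]/(lhom_fun (gcounit u) m).
  by rewrite -[m in LHS](coact_counit m) -gcounit_lact uE /= coact_counit.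
have uK : smem (kerm (ihD M N)) u.
  rewrite -[smem _ _]/(ihD M N u = 0) ihDE.
  apply: (lact_coact_inj eP) => m.
  rewrite (@gmap_sub _ _ (mklin (@del0_linear k H M N)) (@lact_coactl M N)); last first.
    by move=> v; apply: lin_ext => p.
  rewrite lactDl lactNl lact_coact_assoc uE.
  rewrite (_ : gmap _ _ = gmap (postl M (coact N)) u); last first.
    by rewrite -[u in RHS]gassoc_mapcounit gmap_comp.
  by rewrite (@lact_postcomp _ _ _ (coact N)) // uE /= coact_coassoc subrr.
by exists (sub_of uK).
Qed.

End InternalHom.

(** * Dualizability *)

Section Dual.
Variables (flatH : flat H) (M N : comodule H).
Local Notation DM := (ih_obj flatH M (unit_comod H)).
Local Notation dmap :=
  (dual_map (ihom_flat flatH M (unit_comod H)) (ihom_flat flatH M N)).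

Lemma ih_fun_dual_map (d : DM) (x : N) m :
  lhom_fun (ih_fun (dmap (pure d x))) m = (lhom_fun (ih_fun d) m : A) *: x.
Proof.
rewrite -ih_adj_pure.
rewrite -[ih_adj dmap]/(ihom_adj (i := ihom_flat flatH M N) dmap) ihom_adj_invK.
rewrite -[LHS]/(unitl N (tmapl (ihom_ev (ihom_flat flatH M (unit_comod H)))
  idfun (swap DM N M (pure (pure d x) m)))).
rewrite swap_pure tmapl_pure unitl_pure.
by rewrite -[ihom_ev _ _]/(ih_adj (comod_id DM) (pure d m)) ih_adj_pure.
Qed.

Lemma comod_iso_can (P Q : comodule H) (f : comod_hom P Q) (g : {linear Q -> P}) :
  cancel f g -> cancel g f -> comod_iso f.
Proof.
move=> fK gK.
have gco q : coact P (g q) = gmap g (coact Q q).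
  rewrite -{2}[q]gK hom_coact gmap_comp -[LHS]gmap_id.
  by apply: eq_gmap => p /=; rewrite fK.
by exists (ComodHom gco).
Qed.

Section DualBasis.
Variables (n : nat) (e : 'I_n -> M) (phi : 'I_n -> lhom M A^o).
Hypothesis eP : dual_basis e phi.
Variable d : 'I_n -> DM.
Hypothesis dE : forall i, ih_fun (d i) = phi i.

(** The map f |-> sum_i phi_i (x) f(e_i), seen through [ih_fun]. *)
Definition dual_inv (t : ih_obj flatH M N) : tens DM N :=
  \sum_(i < n) pure (d i) (lhom_fun (ih_fun t) (e i)).

Lemma dual_inv_linear : linear dual_inv.
Proof.
move=> a s t; rewrite /dual_inv scaler_sumr -big_split.
apply: eq_bigr => i _ /=; rewrite ih_fun_linear scale_pure pureZ.
by rewrite -pureDr.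
Qed.

Definition dual_invl : {linear ih_obj flatH M N -> smash DM N} :=
  mklin dual_inv_linear.

Lemma dual_map_inv : cancel dual_invl dmap.
Proof.
move=> t; apply: (@ih_fun_inj flatH _ _ _ _ _ eP); apply: lin_ext => m.
rewrite -[LHS]/(ih_funl _ _ _ _ m).
pose h (s : smash DM N) : N := lhom_fun (ih_fun (dmap s)) m.
have hD s s' : h (s + s') = h s + h s'.
  by rewrite /h linearD -[ih_fun _]/(ih_funl _ _ _ _) linearD.
have h0 : h 0 = 0 by apply: (addrI (h 0)); rewrite -hD !addr0.
rewrite -[LHS]/(h (dual_inv t)) /dual_inv (big_morph h hD h0).
rewrite -[RHS]/(lhom_fun (ih_fun t) m) -[in RHS](eP m) linear_sum.
by apply: eq_bigr => i _; rewrite /h ih_fun_dual_map dE linearZ_LR.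
Qed.

Lemma dual_inv_map : cancel dmap dual_invl.
Proof.
move=> t; move: t.
apply: (@lin_tens_ext _ _ _ _ (dual_invl \o dmap) idfun) => c x.
rewrite -[LHS]/(dual_inv (dmap (pure c x))) /dual_inv.
pose p (b : DM) : tens DM N := pure b x.
have pD b b' : p (b + b') = p b + p b' by apply: pureDl.
have p0 : p 0 = 0 by apply: (addrI (p 0)); rewrite -pD !addr0.
transitivity (\sum_(i < n) p ((lhom_fun (ih_fun c) (e i) : A) *: d i)).
  by apply: eq_bigr => i _; rewrite ih_fun_dual_map -pureZ.
rewrite -(big_morph p pD p0) /p /=; congr pure.
apply: (@ih_fun_inj flatH M (unit_comod H) _ _ _ eP); apply: lin_ext => m.
pose h (b : DM) : A^o := lhom_fun (ih_fun b) m.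
have hD b b' : h (b + b') = h b + h b'.
  by rewrite /h -[ih_fun (b + b')]/(ih_funl _ _ _ (b + b')) linearD.
have h0 : h 0 = 0 by apply: (addrI (h 0)); rewrite -hD !addr0.
rewrite -[LHS]/(h _) (big_morph h hD h0).
rewrite -[RHS]/(lhom_fun (ih_fun c) m) -[in RHS](eP m) linear_sum.
apply: eq_bigr => i _.
rewrite /h -[ih_fun _]/(ih_funl _ _ _ _) linearZ_LR linearZ_LR.
rewrite -[ih_funl _ _ _ _]/(ih_fun _) dE.
exact: mulrC.
Qed.

End DualBasis.
End Dual.

Lemma dual_basis_dualizable (flatH : flat H) (M : comodule H) n
    (e : 'I_n -> M) phi :
  dual_basis e phi -> dualizable flatH M.
Proof.
move=> eP N.
have [d dE] := choice (fun i => ih_fun_surj flatH (N := unit_comod H) eP (phi i)).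
exact: comod_iso_can (@dual_inv_map _ _ N _ _ _ eP _ dE) (dual_map_inv eP dE).
Qed.

Lemma dualizable_dual_basis (flatH : flat H) (M : comodule H) :
  dualizable flatH M -> exists n (e : 'I_n -> M) phi, dual_basis e phi.
Proof.
move=> /(_ M) [g [_ gK]].
(* c classifies the identity of M, so t is the coevaluation at 1. *)
pose c := ih_adj_inv flatH (smash_unitl M).
pose t := g (c 1).
have tE m : lhom_fun (ih_fun (dual_map (ihom_flat flatH M (unit_comod H))
    (ihom_flat flatH M M) t)) m = m.
  rewrite gK -ih_adj_pure ih_adj_invK.
  by rewrite -[LHS]/(unitl M (pure (1 : A^o) m)) unitl_pure scale1r.
have [l lE] : exists l, tens_of l = t by exists (repr t); apply: reprK_tens.
exists (size l), (fun i => (tnth (in_tuple l) i).2).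
exists (fun i => ih_fun (tnth (in_tuple l) i).1) => m.
rewrite -[RHS]tE -lE.
rewrite -(big_tnth _ _ l xpredT
  (fun p => (lhom_fun (ih_fun p.1) m : A) *: p.2)).
elim: l {lE} => [|[d x] l IH].
  by rewrite big_nil tens_nil linear0 -[ih_fun _]/(ih_funl _ _ _ _) linear0.
rewrite big_cons tens_cons IH linearD -[ih_fun (_ + _)]/(ih_funl _ _ _ _) linearD.
by rewrite -[RHS]/(lhom_fun (ih_fun _) m + lhom_fun (ih_fun _) m) ih_fun_dual_map.
Qed.

End Comodules.

Theorem proposition1p3p4 (k : comPzRingType) (H : hopf_algebroid k)
    (flatH : flat H) (M : comodule H) :
  dualizable flatH M <-> finitely_generated M /\ projective M.
Proof.
split=> [/dualizable_dual_basis[n [e [phi eP]]] | [fgM prM]].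
  by split; [exact: dual_basis_fg eP | exact: dual_basis_projective eP].
have [n [e [phi eP]]] := fg_projective_dual_basis fgM prM.
exact: dual_basis_dualizable eP.
Qed.
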